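(* Let $\mathcal{H}$ be a finite family of connected graphs. For $\mu\in\{\mathrm{insc},\mathrm{insp},\mathrm{inpc},\mathrm{inpp}\}$ say that $\mathcal{H}$ satisfies (P-$\mu$) if there exists a constant $c(\mathcal{H})$ with $\mu(G)\le c(\mathcal{H})$ for every connected $\mathcal{H}$-free graph $G$. Then: (i) $\mathcal{H}$ satisfies (P-$\mathrm{insc}$) if and only if $\mathcal{H}\le\{K_n,S^*_n,P_n\}$ for some integer $n\ge4$; (ii) $\mathcal{H}$ satisfies (P-$\mathrm{insp}$) if and only if $\mathcal{H}\le\{K_n,S^*_n,\tilde S_n,P_n\}$ for some integer $n\ge4$; (iii) $\mathcal{H}$ satisfies (P-$\mathrm{inpc}$) if and only if $\mathcal{H}\le\{K_n,K_{1,n},F^{(1)}_n,F^{(2)}_n\}$ for some integer $n\ge4$; (iv) $\mathcal{H}$ satisfies (P-$\mathrm{inpp}$) if and only if $\mathcal{H}\le\{K_n,K_{1,n},F^{(1)}_n,F^{(2)}_n,F^{(4)}_n,F^{(5)}_n\}$ for some integer $n\ge4$.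
   Context: Graphs are finite and simple. $G$ is $\mathcal{H}$-free if it has no induced subgraph isomorphic to a member of $\mathcal{H}$. $\mathcal{H}_1\le\mathcal{H}_2$ means every member of $\mathcal{H}_2$ contains an induced subgraph isomorphic to some member of $\mathcal{H}_1$. For a family $\mathcal{A}$, an induced $\mathcal{A}$-cover of $G$ is a family of induced subgraphs of $G$ each isomorphic to a member of $\mathcal{A}$ whose vertex sets cover $V(G)$; an induced $\mathcal{A}$-partition has pairwise vertex-disjoint members. With $\mathcal{A}_s=\{K_1\}\cup\{K_{1,m}:m\ge1\}$ and $\mathcal{A}_p=\{P_m:m\ge1\}$: $\mathrm{insc}$, $\mathrm{insp}$ are the minimum sizes of an induced $\mathcal{A}_s$-cover, $\mathcal{A}_s$-partition; $\mathrm{inpc}$, $\mathrm{inpp}$ those of an induced $\mathcal{A}_p$-cover, $\mathcal{A}_p$-partition. $K_n$: complete graph; $K_{1,n}$: star of order $n+1$; $P_n$: path of order $n$. With $A=\{x_i,y_i,z_i:1\le i\le n\}$: $S^*_n$: vertices $A\setminus\{x_i:2\le i\le n\}$, edges $x_1y_i,y_iz_i$ ($1\le i\le n$). $\tilde S_n$: $S^*_n$ plus edges $x_1z_i$ ($1\le i\le n$). $F^{(1)}_n$: vertices $A\setminus\{x_i:3\le i\le n\}$, edges $x_1x_2,x_1y_1,x_1z_1$, $y_iy_{i+1},z_iz_{i+1}$ ($1\le i\le n-1$). $F^{(2)}_n$: vertices $A\setminus\{x_i:2\le i\le n\}$, edges $x_1y_1,x_1z_1,y_1z_1$, $y_iy_{i+1},z_iz_{i+1}$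 ($1\le i\le n-1$). $F^{(4)}_n$: vertices $\{x_1,x_2\}\cup\{y_i,z_i:1\le i\le n\}$, edges $x_1y_1,x_1z_1,x_2y_1,x_2z_1$, $y_iy_{i+1},z_iz_{i+1}$ ($1\le i\le n-1$). $F^{(5)}_n$: $F^{(4)}_n$ plus the edge $x_1x_2$. *)

(* Defs.v *)
From HB Require Import structures.
From mathcomp Require Import all_boot.
From mathcomp Require Import boolp.

Set Implicit Arguments.
Unset Strict Implicit.
Unset Printing Implicit Defensive.

Record sgraph := SGraph {
  vertex :> finType;
  adj : rel vertex;
  adj_sym : symmetric adj;
  adj_irr : irreflexive adj
}.

Section FromEdges.
Variables (T : finType) (e : rel T).

Definition edge_rel : rel T := [rel u v | (u != v) && (e u v || e v u)].

Lemma edge_rel_sym : symmetric edge_rel.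
Proof. by move=> u v; rewrite /edge_rel /= eq_sym orbC. Qed.

Lemma edge_rel_irr : irreflexive edge_rel.
Proof. by move=> u; rewrite /edge_rel /= eqxx. Qed.

(* The simple graph on T whose edges are the uv with u <> v and e u v or e v u;
   each edge thus needs to be listed in e in one orientation only. *)
Definition graph_of_edges : sgraph := SGraph edge_rel_sym edge_rel_irr.

End FromEdges.

Section Induced.
Variables (G : sgraph) (S : {set G}).

Definition induced_adj : rel {x : G | x \in S} :=
  [rel u v | adj (val u) (val v)].

Lemma induced_adj_sym : symmetric induced_adj.
Proof. by move=> u v; exact: adj_sym. Qed.

Lemma induced_adj_irr : irreflexive induced_adj.
Proof. by move=> u; exact: adj_irr. Qed.

Definition induced : sgraph := SGraph induced_adj_sym induced_adj_irr.

End Induced.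

Definition isomorphic (G H : sgraph) : Prop :=
  exists2 f : G -> H, bijective f & forall x y, adj (f x) (f y) = adj x y.

Definition connected_graph (G : sgraph) : Prop :=
  0 < #|G| /\ forall x y : G, connect (@adj G) x y.

Definition has_induced (G H : sgraph) : Prop :=
  exists S : {set G}, isomorphic (induced S) H.

(* classical_sets.set (hence finite_set) cannot be applied to sgraph: its
   universe lies strictly below that of finType. *)
Definition graph_family := sgraph -> Prop.

Definition finite_family (F : graph_family) : Prop :=
  exists (k : nat) (g : 'I_k -> sgraph), forall G, F G <-> exists i, G = g i.

Definition no_graph : graph_family := fun=> False.

Definition add_graph (H : sgraph) (F : graph_family) : graph_family :=
  fun G => G = H \/ F G.

Notation "[ 'graphs' a ; .. ; b ]" :=
  (add_graph a .. (add_graph b no_graph) ..)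
  (at level 0, a at level 99, b at level 99,
   format "[ 'graphs'  a ;  .. ;  b ]").

Definition free (F : graph_family) (G : sgraph) : Prop :=
  forall H, F H -> ~ has_induced G H.

Definition family_le (F1 F2 : graph_family) : Prop :=
  forall H2, F2 H2 -> exists2 H1, F1 H1 & has_induced H2 H1.

Definition complete_graph (n : nat) : sgraph :=
  graph_of_edges (fun _ _ : 'I_n => true).

Definition path_graph (n : nat) : sgraph :=
  graph_of_edges (fun i j : 'I_n => j == i.+1 :> nat).

(* K_{1,n}; None is the centre. *)
Definition star_graph (n : nat) : sgraph :=
  graph_of_edges (fun u v : option 'I_n => (u == None) && (v != None)).

(* The vertices x_1..x_k, y_1..y_n, z_1..z_n; indices are shifted to start
   at 0, so that x_1, y_1, z_1 are Xv 0, Yv 0, Zv 0. *)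
Notation xyz k n := ('I_k + ('I_n + 'I_n))%type.
Notation Xv a := (inl a).
Notation Yv i := (inr (inl i)).
Notation Zv i := (inr (inr i)).

Definition Sstar_edge n (u v : xyz 1 n) : bool :=
  match u, v with
  | Xv _, Yv _ => true
  | Yv i, Zv j => i == j
  | _, _ => false
  end.

Definition Sstar (n : nat) : sgraph := graph_of_edges (@Sstar_edge n).

Definition Stilde_edge n (u v : xyz 1 n) : bool :=
  match u, v with
  | Xv _, Zv _ => true
  | _, _ => Sstar_edge u v
  end.

Definition Stilde (n : nat) : sgraph := graph_of_edges (@Stilde_edge n).

(* The edges y_i y_{i+1} and z_i z_{i+1}. *)
Definition legs_edge k n (u v : xyz k n) : bool :=
  match u, v with
  | Yv i, Yv j => j == i.+1 :> nat
  | Zv i, Zv j => j == i.+1 :> nat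
  | _, _ => false
  end.

Definition F1_edge n (u v : xyz 2 n) : bool :=
  match u, v with
  | Xv a, Xv b => (a == 0 :> nat) && (b == 1 :> nat)
  | Xv a, Yv j => (a == 0 :> nat) && (j == 0 :> nat)
  | Xv a, Zv j => (a == 0 :> nat) && (j == 0 :> nat)
  | _, _ => legs_edge u v
  end.

Definition F1 (n : nat) : sgraph := graph_of_edges (@F1_edge n).

Definition F2_edge n (u v : xyz 1 n) : bool :=
  match u, v with
  | Xv _, Yv j => j == 0 :> nat
  | Xv _, Zv j => j == 0 :> nat
  | Yv i, Zv j => (i == 0 :> nat) && (j == 0 :> nat)
  | _, _ => legs_edge u v
  end.

Definition F2 (n : nat) : sgraph := graph_of_edges (@F2_edge n).

Definition F4_edge n (u v : xyz 2 n) : bool :=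
  match u, v with
  | Xv _, Yv j => j == 0 :> nat
  | Xv _, Zv j => j == 0 :> nat
  | _, _ => legs_edge u v
  end.

Definition F4 (n : nat) : sgraph := graph_of_edges (@F4_edge n).

Definition F5_edge n (u v : xyz 2 n) : bool :=
  match u, v with
  | Xv a, Xv b => a != b
  | _, _ => F4_edge u v
  end.

Definition F5 (n : nat) : sgraph := graph_of_edges (@F5_edge n).

Definition star_family : graph_family :=
  fun G => G = complete_graph 1 \/ exists2 m, 1 <= m & G = star_graph m.

Definition path_family : graph_family :=
  fun G => exists2 m, 1 <= m & G = path_graph m.

(* Induced subgraphs of G are represented by their vertex sets. *)
Definition induced_cover (A : graph_family) (G : sgraph) (C : {set {set G}}) :
    Prop :=
  (forall S, S \in C -> exists2 H, A H & isomorphic (induced S) H) /\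
  cover C = [set: G].

Definition induced_partition (A : graph_family) (G : sgraph)
    (C : {set {set G}}) : Prop :=
  induced_cover A C /\ trivIset C.

Definition has_size (T : finType) (P : {set {set T}} -> Prop) : pred nat :=
  fun k => `[< exists2 C, P C & #|C| = k >].

Definition min_size (T : finType) (P : {set {set T}} -> Prop)
  (exP : exists k, has_size P k) : nat := ex_minn exP.

Lemma induced_set1 (H : sgraph) (h : H) (G : sgraph) (x : G) :
  (forall h', h' = h) -> isomorphic (induced [set x]) H.
Proof.
move=> Hh; have inx : x \in [set x] by rewrite inE.
exists (fun=> h).
  exists (fun=> exist _ x inx) => [[y iny]|h']; last by rewrite (Hh h').
  by apply: val_inj => /=; move: iny; rewrite inE => /eqP.
move=> [y iny] [z inz]; rewrite adj_irr /induced /= /induced_adj /=.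
by move: iny inz; rewrite !inE => /eqP-> /eqP->; rewrite adj_irr.
Qed.

Lemma partition_exists (A : graph_family) (H : sgraph) (h : H) (G : sgraph) :
  A H -> (forall h', h' = h) -> exists k, has_size (@induced_partition A G) k.
Proof.
move=> AH Hh; set C := [set [set x] | x in [set: G]].
exists #|C|; apply/asboolP; exists C => //; split; first split.
- by move=> _ /imsetP[x _ ->]; exists H => //; exact: induced_set1 Hh.
- apply/setP => x; rewrite inE; apply/bigcupP; exists [set x].
    exact: imset_f.
  by rewrite inE.
- apply/trivIsetP => _ _ /imsetP[x _ ->] /imsetP[y _ ->].
  by move=> xy; rewrite disjoints1 inE; apply: contraNN xy => /eqP->.
Qed.

Lemma cover_exists (A : graph_family) (G : sgraph) :
  (exists k, has_size (@induced_partition A G) k) ->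
  exists k, has_size (@induced_cover A G) k.
Proof.
move=> [k /asboolP[C [CA _] Ck]]; exists k; apply/asboolP.
by exists C.
Qed.

Lemma star_partition_exists (G : sgraph) :
  exists k, has_size (@induced_partition star_family G) k.
Proof.
apply: (@partition_exists _ (complete_graph 1) (@ord0 0)); first by left.
by move=> h'; rewrite [h']ord1.
Qed.

Lemma path_partition_exists (G : sgraph) :
  exists k, has_size (@induced_partition path_family G) k.
Proof.
apply: (@partition_exists _ (path_graph 1) (@ord0 0)); first by exists 1.
by move=> h'; rewrite [h']ord1.
Qed.

Definition insc (G : sgraph) : nat :=
  min_size (cover_exists (star_partition_exists G)).
Definition insp (G : sgraph) : nat := min_size (star_partition_exists G).
Definition inpc (G : sgraph) : nat :=
  min_size (cover_exists (path_partition_exists G)).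
Definition inpp (G : sgraph) : nat := min_size (path_partition_exists G).

Definition bounded_on_free (mu : sgraph -> nat) (F : graph_family) : Prop :=
  exists c : nat, forall G, connected_graph G -> free F G -> mu G <= c.

(* Main.v *)
Require Import Defs.
From HB Require Import structures.
From mathcomp Require Import all_boot.
From mathcomp Require Import boolp zify.

Set Implicit Arguments.
Unset Strict Implicit.
Unset Printing Implicit Defensive.

(**
Stars.  Take the distance layers from a root.  A minimal set of vertices of
one layer dominating the next one has private neighbours, so if it were large,
Ramsey's theorem and the bounded domination of the layer itself would give an
induced [Sstar n]; excluding [path_graph n] bounds the number of layers, hence
the domination number.  Induction on the clique number, applied to the
components of the neighbourhoods [N(x)] of the dominating vertices, bounds the
chromatic number, and the stars formed by [x] and a colour class of [N(x)]
cover the graph.  Without [Stilde n] at most [n] components of (a part of)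
[N(x)] are nontrivial: these are partitioned by induction, and the isolated
vertices form a star with [x].

Paths.  Without [complete_graph n] and [star_graph n] the degrees are bounded.
Let [p] be a longest induced path.  Excluding [F1 n] and [F2 n] forces every
neighbour of a vertex far from the ends of [p] to be a twin, with respect to
[p], of some [p i]; the transversals of the twin classes are induced paths,
and the remaining vertices stay within bounded distance of the ends since [p]
is longest.  Excluding [F4 n] and [F5 n] makes the twin classes trivial.

Conversely, [F1 n], [F2 n], [F4 n] and [F5 n] themselves have small covers.
However, a long path carrying many copies of the gadget of one of them, far
apart from each other, has no small cover, and a connected graph on at most
[n] vertices occurring in it also occurs in a single copy.
*)

(** * Embeddings and induced paths *)

Definition emb (H G : sgraph) : Prop :=
  exists2 f : H -> G, injective f & forall x y, adj (f x) (f y) = adj x y.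

Lemma emb_trans (H K G : sgraph) : emb H K -> emb K G -> emb H G.
Proof.
move=> [f fI fA] [g gI gA]; exists (g \o f); first exact: inj_comp.
by move=> x y /=; rewrite gA fA.
Qed.

Lemma induced_image (H G : sgraph) (f : H -> G) (S : {set G}) :
  injective f -> (forall x y, adj (f x) (f y) = adj x y) ->
  f @: [set: H] = S -> isomorphic (induced S) H.
Proof.
move=> fI fA fS.
have SC x : x \in S -> x \in codom f.
  by rewrite -fS => /imsetP[h _ ->]; exact: codom_f.
have inS (u : induced S) : val u \in codom f := SC _ (valP u).
have fin (h : H) : f h \in S by rewrite -fS imset_f.
exists (fun u => iinv (inS u)).
  exists (fun h => exist _ (f h) (fin h) : induced S).
    by move=> u; apply: val_inj; rewrite /= f_iinv.
  by move=> h; apply: fI; rewrite f_iinv.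
by move=> x y; rewrite -fA !f_iinv.
Qed.

Lemma has_inducedP (G H : sgraph) : has_induced G H <-> emb H G.
Proof.
split=> [[S [f [g fK gK] fA]]|[f fI fA]].
  exists (val \o g); first exact: inj_comp val_inj (can_inj gK).
  by move=> x y; rewrite -{2}(gK x) -{2}(gK y) fA.
by exists (f @: [set: H]); exact: induced_image fA _.
Qed.

Lemma emb_induced (G : sgraph) (S : {set G}) : emb (induced S) G.
Proof. by exists val; first exact: val_inj. Qed.

(** A path is a function on [nat] of which only the values below [m] matter, so that reversal,
    truncation and concatenation become index arithmetic. The two equations are paired so that one
    hypothesis rewrites both equality and adjacency. *)
Definition ipath (G : sgraph) (p : nat -> G) (m : nat) : Prop :=
  forall i j, i < m -> j < m ->
    ((p i == p j) = (i == j)) *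
    (adj (p i) (p j) = (i.+1 == j) || (j.+1 == i)).

Lemma path_graph_adj m (i j : 'I_m) :
  adj (i : path_graph m) j = (i.+1 == j) || (j.+1 == i).
Proof.
have -> : adj (i : path_graph m) j =
    (i != j) && ((j == i.+1 :> nat) || (i == j.+1 :> nat)) by [].
by rewrite -val_eqE /=; lia.
Qed.

Lemma emb_path (G : sgraph) (p : nat -> G) m :
  ipath p m -> emb (path_graph m) G.
Proof.
move=> pP; exists (fun i : 'I_m => p i).
  by move=> i j /eqP; rewrite pP // => /eqP/val_inj.
by move=> i j; rewrite pP // path_graph_adj.
Qed.

Lemma ipath_iso (G : sgraph) (p : nat -> G) m : ipath p m ->
  isomorphic (induced [set p i | i : 'I_m]) (path_graph m).
Proof.
move=> pP; apply: (@induced_image _ _ (fun i : path_graph m => p (i : 'I_m))).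
- by move=> i j /eqP; rewrite pP // => /eqP/val_inj.
- by move=> i j; rewrite pP // path_graph_adj.
- by apply/setP => x; apply/imsetP/imsetP => -[i _ ->]; exists i.
Qed.

Lemma ipath_le (G : sgraph) (p : nat -> G) m m' :
  m' <= m -> ipath p m -> ipath p m'.
Proof. by move=> mm pP i j im jm; split; rewrite pP; lia. Qed.

Lemma ipath_card (G : sgraph) (p : nat -> G) m : ipath p m -> m <= #|G|.
Proof.
move=> pP; rewrite -[m]card_ord; apply: (@leq_card _ _ (fun i : 'I_m => p i)).
by move=> i j /eqP; rewrite pP // => /eqP/val_inj.
Qed.

Lemma ipath_rev (G : sgraph) (p : nat -> G) m :
  ipath p m -> ipath (fun k => p (m.-1 - k)) m.
Proof. by move=> pP i j im jm; split; rewrite pP; lia. Qed.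

Lemma ipath_cat (G : sgraph) (p q : nat -> G) l r :
  ipath p l -> ipath q r ->
  (forall i j, i < l -> j < r ->
    p i != q j /\ adj (p i) (q j) = (i.+1 == l) && (j == 0)) ->
  ipath (fun k => if k < l then p k else q (k - l)) (l + r).
Proof.
move=> pP qP pq i j im jm.
case: (ltnP i l) => il; case: (ltnP j l) => jl.
- by rewrite !pP.
- have [|/negPf-> ->] := pq i (j - l) il; first lia.
  by split; lia.
- have [|npq apq] := pq j (i - l) jl; first lia.
  by rewrite eq_sym (negPf npq) adj_sym apq; split; lia.
- by split; rewrite qP; lia.
Qed.

Lemma card_bigcup_leq (I T : finType) (A : {set I}) (F : I -> {set T}) b :
  (forall i, i \in A -> #|F i| <= b) -> #|\bigcup_(i in A) F i| <= #|A| * b.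
Proof.
move=> Fb; rewrite -sum_nat_const; apply: (@leq_trans (\sum_(i in A) #|F i|)); last exact: leq_sum.
elim/big_rec2: _ => [|x n1 n2 _ le2]; first by rewrite cards0.
by apply: leq_trans (leq_card_setU _ _) _; rewrite leq_add2l.
Qed.

(** * Balls and distance layers *)

Section Layers.
Variables (T : finType) (e : rel T) (A : {set T}).

(** The relation and the source set are parameters: layers are taken later both for the adjacency of
    a graph from one root and for the adjacency restricted to the complement of a tube, from a whole
    set. *)
Fixpoint ball k : {set T} :=
  if k is k'.+1 then ball k' :|: [set y | [exists x in ball k', e x y]] else A.

Definition layer k : {set T} :=
  if k is k'.+1 then ball k :\: ball k' else A.

Lemma ball_step k x y : x \in ball k -> e x y -> y \in ball k.+1.
Proof. by move=> xk xy; rewrite !inE; apply/orP; right; apply/existsP; exists x; rewrite xk. Qed.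

Lemma ball_mono k l : k <= l -> ball k \subset ball l.
Proof.
move=> kl; rewrite -(subnKC kl); elim: (l - k) => [|m IH]; first by rewrite addn0.
by rewrite addnS; apply: subset_trans IH (subsetUl _ _).
Qed.

Lemma layer_ball k : layer k \subset ball k.
Proof. by case: k => [|k] //; exact: subsetDl. Qed.

Lemma ball_layer k x : x \in ball k -> exists2 l, l <= k & x \in layer l.
Proof.
elim: k => [|k IH] xk; first by exists 0.
have [/IH[l lk xl]|xNk] := boolP (x \in ball k); first by exists l => //; lia.
by exists k.+1 => //; rewrite inE xNk.
Qed.

Lemma layer_notin_ball i j x : i < j -> x \in layer j -> x \notin ball i.
Proof.
case: j => // j ij; rewrite inE => /andP[xj _]; apply: contraNN xj.
by apply/subsetP; apply: ball_mono.
Qed.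

Lemma layer_neq i j x y : i < j -> x \in layer i -> y \in layer j -> x != y.
Proof.
move=> ij xi /(layer_notin_ball ij); apply: contraNneq => <-.
exact: (subsetP (layer_ball i)).
Qed.

Lemma layer_far i j x y : i.+1 < j -> x \in layer i -> y \in layer j -> ~~ e x y.
Proof.
move=> ij xi /(layer_notin_ball ij); apply: contraNN.
exact: ball_step (subsetP (layer_ball i) _ xi).
Qed.

Lemma layer_pred k y : y \in layer k.+1 -> exists2 x, x \in layer k & e x y.
Proof.
move=> yk; have := yk; rewrite inE => /andP[yNk]; rewrite inE (negPf yNk) inE.
case/existsP=> x /andP[xk xy]; exists x => //.
have [l lk xl] := ball_layer xk.
have [->//|lk'] := eqVneq k l.
have lkk : l.+1 < k.+1 by lia.
by have := layer_far lkk xl yk; rewrite xy.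
Qed.

Lemma layer_path k y : y \in layer k -> exists p : nat -> T,
  [/\ p k = y, forall i, i <= k -> p i \in layer i
    & forall i, i < k -> e (p i) (p i.+1)].
Proof.
elim: k y => [|k IH] y yk.
  by exists (fun=> y); split=> // i; rewrite leqn0 => /eqP->.
have [x xk xy] := layer_pred yk; have [p [px pl pe]] := IH x xk.
exists (fun i => if i == k.+1 then y else p i); split=> [|i|i].
- by rewrite eqxx.
- by case: eqP => [->//|ik] ik1; apply: pl; lia.
- move=> ik; have -> : (i == k.+1) = false by lia.
  rewrite eqSS; case: eqP => [->|ik']; first by rewrite px.
  by apply: pe; lia.
Qed.

Lemma ball_card D k : (forall x, #|[set y | e x y]| <= D) ->
  #|ball k| <= D.+1 ^ k * #|A|.
Proof.
move=> De; elim: k => [|k IH] /=; first by rewrite mul1n.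
have sub : [set y | [exists x in ball k, e x y]] \subset
    \bigcup_(x in ball k) [set y | e x y].
  apply/subsetP => y; rewrite inE => /existsP[x /andP[xk xy]].
  by apply/bigcupP; exists x; rewrite ?inE.
have le1 : #|\bigcup_(x in ball k) [set y | e x y]| <= D * #|ball k|.
  by rewrite mulnC; apply: card_bigcup_leq.
have le2 := subset_leq_card sub.
have le3 := (leq_card_setU (ball k) [set y | [exists x in ball k, e x y]]).1.
rewrite expnS -mulnA; nia.
Qed.

End Layers.
Arguments ball : simpl never.
Arguments layer : simpl never.

(** Such a [p] is a geodesic from [A]: its vertices lie in different layers, and no [e]-edge skips a
    layer, so it has no chord. The last hypothesis carries this over from [e] to adjacency. *)
Lemma layer_ipath (G : sgraph) (e : rel G) (A : {set G}) (p : nat -> G) k :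
  (forall i, i <= k -> p i \in layer e A i) ->
  (forall i, i < k -> e (p i) (p i.+1)) ->
  (forall i j, i <= k -> j <= k -> i != j -> adj (p i) (p j) = e (p i) (p j)) ->
  ipath p k.+1.
Proof.
move=> pl pe pa.
suff H i j : i < j -> j <= k ->
    (p i == p j) = false /\ adj (p i) (p j) = (i.+1 == j).
  move=> i j im jm; case: (ltngtP i j) => [ij|ji|->].
  - by have [-> ->] := H i j ij jm; split; lia.
  - by have [E1 E2] := H j i ji im; rewrite eq_sym E1 adj_sym E2; split; lia.
  - by rewrite eqxx adj_irr; split; lia.
move=> ij jk; split.
  by apply/negbTE; apply: (layer_neq ij (pl _ _) (pl _ jk)); lia.
rewrite pa //; try lia.
case: eqP => [<-|ne]; first by apply: pe; lia.
by apply/negbTE; apply: (@layer_far _ _ A i j) => //; [lia|apply: pl; lia|apply: pl].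
Qed.

Lemma connected_closed (G : sgraph) (P : G -> Prop) (r : G) : connected_graph G ->
  P r -> (forall x y, P x -> adj x y -> P y) -> forall x, P x.
Proof.
move=> [_ cG] Pr Pe x; have /connectP[s sp ->] := cG r x.
elim: s r Pr sp => //= y s IH r Pr /andP[ry ys].
exact: IH (Pe _ _ Pr ry) ys.
Qed.

Lemma connected_layer (G : sgraph) (r x : G) : connected_graph G ->
  exists k, x \in layer (@adj G) [set r] k.
Proof.
move=> cG.
have [k /ball_layer[l _ xl]] : exists k, x \in ball (@adj G) [set r] k; last by exists l.
move: x; apply: (connected_closed cG (r := r)).
  by exists 0; rewrite inE.
by move=> x y [k xk] xy; exists k.+1; exact: ball_step xy.
Qed.

(** * Finite sets and Ramsey's theorem *)

Lemma subset_card (T : finType) (A : {set T}) n : n <= #|A| ->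
  exists2 B : {set T}, B \subset A & #|B| = n.
Proof.
move=> nA.
have /card_gt0P[B] : 0 < #|[set B : {set T} | B \subset A & #|B| == n]|.
  by rewrite cards_draws bin_gt0.
by rewrite inE => /andP[BA /eqP Bn]; exists B.
Qed.

(** The usual double induction, with [R(a+1,b+1) <= R(a,b+1) + R(a+1,b) + 1]: a vertex [v] has many
    neighbours or many non-neighbours in [A]. The relation is arbitrary because it is also used for
    an adjacency pulled back along a map. *)
Lemma ramsey a b : exists R, forall (T : finType) (e : rel T), symmetric e ->
  forall A : {set T}, R <= #|A| ->
    (exists B : {set T}, [/\ B \subset A, #|B| = a &
        {in B &, forall x y, x != y -> e x y}]) \/
    (exists B : {set T}, [/\ B \subset A, #|B| = b &
        {in B &, forall x y, x != y -> ~~ e x y}]).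
Proof.
elim: a b => [|a IHa] b.
  exists 0 => T e _ A _; left; exists set0; rewrite cards0; split=> //.
    exact: sub0set.
  by move=> x y; rewrite inE.
elim: b => [|b [R2 H2]].
  exists 0 => T e _ A _; right; exists set0; rewrite cards0; split=> //.
    exact: sub0set.
  by move=> x y; rewrite inE.
have [R1 H1] := IHa b.+1.
exists (R1 + R2).+1 => T e eS A cA.
have /card_gt0P[v vA] : 0 < #|A| by lia.
pose A1 := [set x in A :\ v | e v x]; pose A2 := [set x in A :\ v | ~~ e v x].
have cA12 : #|A1| + #|A2| = #|A|.-1.
  have := cardsID [set x | e v x] (A :\ v); have := cardsD1 v A.
  have -> : (A :\ v) :&: [set x | e v x] = A1 by apply/setP => x; rewrite !inE.
  have -> : (A :\ v) :\: [set x | e v x] = A2.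
    by apply/setP => x; rewrite !inE andbC.
  by rewrite vA; lia.
have ext (B : {set T}) (P : pred T) k : B \subset [set x in A :\ v | P x] -> #|B| = k ->
    v |: B \subset A /\ #|v |: B| = k.+1.
  move=> BA Bk; split.
    apply/subsetP => x; rewrite !inE => /orP[/eqP->//|/(subsetP BA)].
    by rewrite !inE => /andP[/andP[]].
  rewrite cardsU1 Bk; suff -> : v \notin B by [].
  by apply/negP => /(subsetP BA); rewrite !inE eqxx.
have [cA1|cA1] := leqP R1 #|A1|.
  have [[B [BA Ba eB]]|[B [BA Bb eB]]] := H1 _ _ eS _ cA1; last first.
    right; exists B; split=> //; apply: subset_trans BA _.
    by apply/subsetP => x; rewrite !inE => /andP[/andP[]].
  left; exists (v |: B); have [? ?] := ext _ _ _ BA Ba; split=> //.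
  have vB x : x \in B -> e v x by move=> /(subsetP BA); rewrite !inE => /andP[].
  move=> x y; rewrite !inE => /orP[/eqP->|xB] /orP[/eqP->|yB].
  - by rewrite eqxx.
  - by move=> _; exact: vB.
  - by move=> _; rewrite eS; exact: vB.
  - exact: eB.
have cA2 : R2 <= #|A2| by lia.
have [[B [BA Ba eB]]|[B [BA Bb eB]]] := H2 _ _ eS _ cA2.
  left; exists B; split=> //; apply: subset_trans BA _.
  by apply/subsetP => x; rewrite !inE => /andP[/andP[]].
right; exists (v |: B); have [? ?] := ext _ _ _ BA Bb; split=> //.
have vB x : x \in B -> ~~ e v x by move=> /(subsetP BA); rewrite !inE => /andP[].
move=> x y; rewrite !inE => /orP[/eqP->|xB] /orP[/eqP->|yB].
- by rewrite eqxx.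
- by move=> _; exact: vB.
- by move=> _; rewrite eS; exact: vB.
- exact: eB.
Qed.

(** * Embeddings of the named graphs *)

Lemma edges_adj (T : finType) (e : rel T) (u v : T) : irreflexive e ->
  adj (u : graph_of_edges e) v = e u v || e v u.
Proof.
move=> eI; have -> : adj (u : graph_of_edges e) v = (u != v) && (e u v || e v u) by [].
by case: eqVneq => [->|//]; rewrite eI.
Qed.

Lemma enum_inj (T : finType) (B : {set T}) n : #|B| = n ->
  exists2 h : 'I_n -> T, injective h & forall i, h i \in B.
Proof.
by move=> <-; exists enum_val; [exact: enum_val_inj|exact: enum_valP].
Qed.

Lemma emb_complete (G : sgraph) n (h : 'I_n -> G) :
  (forall i j, i != j -> adj (h i) (h j)) -> emb (complete_graph n) G.
Proof.
move=> hA; exists (h : complete_graph n -> G).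
  move=> i j hij; apply/eqP/negPn/negP => /hA; by rewrite hij adj_irr.
move=> i j; have -> : adj i j = (i != j) by rewrite /= /edge_rel /= andbT.
by case: eqVneq => [->|/hA//]; rewrite adj_irr.
Qed.

Lemma star_graph_adj m (u v : option 'I_m) :
  adj (u : star_graph m) v = (u == None) (+) (v == None).
Proof. by rewrite edges_adj => [|[i|]] //=; case: u v => [i|] [j|]. Qed.

Lemma emb_star (G : sgraph) n (x : G) (y : 'I_n -> G) :
  injective y -> (forall i, adj x (y i)) -> (forall i j, ~~ adj (y i) (y j)) ->
  emb (star_graph n) G.
Proof.
move=> yI xy yy.
have ne i : x = y i -> False by move=> E; have := xy i; rewrite E adj_irr.
exists (fun u : star_graph n => if u is Some i then y i else x).
  move=> [i|] [j|] // E; first by congr Some; exact: yI.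
    by case: (ne i).
  by case: (ne j).
move=> [i|] [j|]; rewrite star_graph_adj /= ?adj_irr ?xy //.
  exact/negbTE.
by rewrite adj_sym xy.
Qed.

Lemma Sstar_irr n : irreflexive (@Sstar_edge n).
Proof. by case=> [a|[i|i]]. Qed.

Lemma Stilde_irr n : irreflexive (@Stilde_edge n).
Proof. by case=> [a|[i|i]]. Qed.

Definition xyz_fun (T : Type) k n (x : 'I_k -> T) (y z : 'I_n -> T) (u : xyz k n) :=
  match u with Xv a => x a | Yv i => y i | Zv i => z i end.

Lemma emb_Sstar (G : sgraph) n (x : G) (y z : 'I_n -> G) :
  (forall i, x != z i) ->
  (forall i, adj x (y i)) -> (forall i, ~~ adj x (z i)) ->
  (forall i j, adj (y i) (z j) = (i == j)) ->
  (forall i j, ~~ adj (y i) (y j)) -> (forall i j, ~~ adj (z i) (z j)) ->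
  emb (Sstar n) G.
Proof.
move=> xz xy xNz yz yy zz.
have xNy i : x = y i -> False by move=> E; have := xy i; rewrite E adj_irr.
have yNz i j : y i = z j -> False by move=> E; have := xNz j; rewrite -E xy.
have xzN i : x = z i -> False by move=> E; have := xz i; rewrite E eqxx.
exists (xyz_fun (fun=> x) y z : Sstar n -> G).
  case=> [a|[i|i]] [b|[j|j]] //=; try by move=> E; exfalso; eauto.
  - by rewrite (ord1 a) (ord1 b).
  - by move=> E; move: (yz i i); rewrite E yz eqxx => /eqP->.
  - by move=> E; move: (yz i i); rewrite {1}E yz eqxx => /eqP->.
move=> u v; rewrite edges_adj; last exact: Sstar_irr.
case: u v => [a|[i|i]] [b|[j|j]] //=; rewrite ?adj_irr ?xy ?yz ?orbF //;
  try exact/negbTE; rewrite adj_sym ?xy ?yz //.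
exact/negbTE.
Qed.

Lemma emb_Stilde (G : sgraph) n (x : G) (y z : 'I_n -> G) :
  (forall i, adj x (y i)) -> (forall i, adj x (z i)) ->
  (forall i j, adj (y i) (z j) = (i == j)) ->
  (forall i j, ~~ adj (y i) (y j)) -> (forall i j, ~~ adj (z i) (z j)) ->
  emb (Stilde n) G.
Proof.
move=> xy xz yz yy zz.
have xNy i : x = y i -> False by move=> E; have := xy i; rewrite E adj_irr.
have xNz i : x = z i -> False by move=> E; have := xz i; rewrite E adj_irr.
have yNz i j : y i = z j -> False.
  by move=> E; have := zz j i; rewrite -E yz eqxx.
exists (xyz_fun (fun=> x) y z : Stilde n -> G).
  case=> [a|[i|i]] [b|[j|j]] //=; try by move=> E; exfalso; eauto.
  - by rewrite (ord1 a) (ord1 b).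
  - by move=> E; move: (yz i i); rewrite E yz eqxx => /eqP->.
  - by move=> E; move: (yz i i); rewrite {1}E yz eqxx => /eqP->.
move=> u v; rewrite edges_adj; last exact: Stilde_irr.
case: u v => [a|[i|i]] [b|[j|j]] //=; rewrite ?adj_irr ?xy ?xz ?yz ?orbF //;
  try exact/negbTE; by rewrite adj_sym ?xy ?xz ?yz.
Qed.

(** * Domination *)

Section Domination.
Variables (k n : nat).

(** Induction on the layer. A minimal dominating [X] inside layer [m.+1] is split among the at most
    [c] vertices [Y] dominating that layer. If some [y] in [Y] received too many vertices of [X],
    two applications of Ramsey's theorem would make them, and then their private neighbours,
    independent: this is an [Sstar n] centred at [y]. *)
Lemma layer_dom m : exists c, forall G : sgraph,
  ~ emb (complete_graph k) G -> ~ emb (Sstar n) G -> forall r : G,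
  exists X : {set G}, [/\ #|X| <= c, X \subset layer (@adj G) [set r] m
    & forall v, v \in layer (@adj G) [set r] m.+1 -> exists2 x, x \in X & adj x v].
Proof.
elim: m => [|m [c Hc]].
  exists 1 => G _ _ r; exists [set r]; rewrite cards1; split=> //.
  by move=> v /layer_pred[x xr xv]; exists x.
have [R2 HR2] := ramsey k n; have [R1 HR1] := ramsey k R2.
exists (c * R1) => G noK noS r; have [Y [cY sY domY]] := Hc G noK noS r.
set L := layer (@adj G) [set r] in sY domY *.
pose P (X : {set G}) :=
  (X \subset L m.+1) && [forall v in L m.+2, [exists x in X, adj x v]].
have PL : P (L m.+1).
  rewrite /P subxx /=; apply/forallP => v; apply/implyP => /layer_pred[x xL xv].
  by apply/existsP; exists x; rewrite xL.
have [X minX _] := minset_exists PL.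
have := minsetp minX => /andP[sX /forallP domX].
have dX v : v \in L m.+2 -> exists2 x, x \in X & adj x v.
  by move=> vL; have /implyP/(_ vL)/existsP[x /andP[]] := domX v; exists x.
exists X; split=> //.
have [p pP] : exists p : G -> G, forall x, x \in X ->
    p x \in L m.+2 /\ forall x', x' \in X -> adj x' (p x) = (x' == x).
  suff H x : exists v, x \in X ->
    v \in L m.+2 /\ forall x', x' \in X -> adj x' v = (x' == x).
    by have [p pP] := choice H; exists p.
  have [xX|] := boolP (x \in X); last by exists x.
  (* By minimality [x] cannot be dropped, so some vertex two layers above [Y] is dominated, within
     [X], by [x] alone. *)
  have : ~~ P (X :\ x).
    apply/negP => PX; have := minsetinf minX PX (subsetDl _ _).
    by move/setP/(_ x); rewrite !inE xX eqxx.
  rewrite negb_and (subset_trans (subsetDl _ _) sX) /=.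
  move=> /forallPn[v]; rewrite negb_imply => /andP[vL /existsPn nv].
  exists v => _; split=> // x' x'X; case: eqVneq => [->|x'x].
    have [x2 x2X x2v] := dX v vL.
    have := nv x2; rewrite !inE x2X x2v andbT andbT negbK => /eqP E.
    by rewrite -E.
  by have := nv x'; rewrite !inE x'x x'X /= => /negbTE.
have pI x x' : x \in X -> x' \in X -> p x = p x' -> x = x'.
  move=> xX x'X E; have [_ /(_ x xX)] := pP x xX; rewrite E eqxx.
  by have [_ /(_ x xX)->] := pP x' x'X => /eqP.
have coverX : X \subset \bigcup_(y in Y) [set x in X | adj y x].
  apply/subsetP => x xX; have [y yY yx] := domY x (subsetP sX _ xX).
  by apply/bigcupP; exists y => //; rewrite inE xX.
apply: leq_trans (subset_leq_card coverX) _.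
apply: leq_trans (leq_mul cY (leqnn R1)).
apply: card_bigcup_leq => y yY; rewrite leqNgt; apply/negP => /ltnW big.
have [[B [_ Bk BC]]|[B [BA BR2 BI]]] := HR1 _ _ (@adj_sym G) _ big.
  have [h hI hB] := enum_inj Bk; apply: noK.
  by apply: (emb_complete (h := h)) => i j ij; apply: BC => //; rewrite (inj_eq hI).
have BX x : x \in B -> x \in X by move/(subsetP BA); rewrite inE => /andP[].
have By x : x \in B -> adj y x by move/(subsetP BA); rewrite inE => /andP[].
(* The second application compares members of [B] through their private neighbours, so that the
   vertices and their private neighbours are selected together. *)
have e'S : symmetric (fun x x' => adj (p x) (p x')) by move=> x x'; exact: adj_sym.
have [[C [CB Ck CC]]|[C [CB Cn CI]]] := HR2 _ _ e'S B ltac:(by rewrite BR2).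
  have [h hI hC] := enum_inj Ck; apply: noK.
  by apply: (emb_complete (h := p \o h)) => i j ij; apply: CC => //; rewrite (inj_eq hI).
have [h hI hC] := enum_inj Cn; apply: noS.
have hB i : h i \in B := subsetP CB _ (hC i).
have hX i : h i \in X := BX _ (hB i).
have yL := subsetP sY _ yY.
have pL i : p (h i) \in L m.+2 by case: (pP _ (hX i)).
apply: (emb_Sstar (x := y) (y := h) (z := p \o h)) => [i|i|i|i j|i j|i j] /=.
- by apply: (layer_neq _ yL (pL i)).
- exact: By.
- by apply: (layer_far _ yL (pL i)).
- by have [_ ->//] := pP _ (hX j); rewrite (inj_eq hI).
- have [->|ij] := eqVneq i j; first by rewrite adj_irr.
  by apply: BI => //; rewrite (inj_eq hI).
- have [->|ij] := eqVneq i j; first by rewrite adj_irr.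
  by apply: CI => //; rewrite (inj_eq hI).
Qed.

Lemma ball_dom m : exists c, forall G : sgraph,
  ~ emb (complete_graph k) G -> ~ emb (Sstar n) G -> forall r : G,
  exists2 X : {set G}, #|X| <= c
    & forall v, v \in ball (@adj G) [set r] m ->
        v \in X \/ exists2 x, x \in X & adj x v.
Proof.
elim: m => [|m [c Hc]].
  by exists 1 => G _ _ r; exists [set r]; rewrite ?cards1 // => v; left.
have [c' Hc'] := layer_dom m.
exists (c + c') => G noK noS r.
have [X cX dX] := Hc G noK noS r; have [Y [cY _ dY]] := Hc' G noK noS r.
exists (X :|: Y); first by apply: leq_trans (leq_card_setU _ _) _; lia.
move=> v vB; have [/dX[vX|[x xX xv]]|vNB] := boolP (v \in ball (@adj G) [set r] m).
- by left; rewrite inE vX.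
- by right; exists x; rewrite // inE xX.
- have [|x xY xv] := dY v; first by rewrite inE vNB.
  by right; exists x; rewrite // inE xY orbT.
Qed.

Lemma dominating : exists c, forall G : sgraph, connected_graph G ->
  ~ emb (complete_graph k) G -> ~ emb (Sstar n) G -> ~ emb (path_graph n) G ->
  exists2 X : {set G}, #|X| <= c
    & forall v, v \in X \/ exists2 x, x \in X & adj x v.
Proof.
have [c Hc] := ball_dom n; exists c => G cG noK noS noP.
have [/card_gt0P[r _] _] := cG.
have [X cX dX] := Hc G noK noS r; exists X => // v; apply: dX.
(* A vertex in a layer [l > n] would end a geodesic on [l.+1] vertices, which contains
   [path_graph n]. Hence the ball of radius [n] is the whole graph. *)
have [l vl] := connected_layer r v cG.
have [ln|nl] := leqP l n.
  exact: subsetP (ball_mono _ _ ln) _ (subsetP (layer_ball _ _ _) _ vl).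
have [p [_ pl pe]] := layer_path vl; case: noP; apply: (@emb_path _ p).
by apply: (@ipath_le _ _ l.+1); [lia|apply: layer_ipath pl pe _].
Qed.

End Domination.

(** * Components of induced subgraphs *)

Section Components.
Variables (G : sgraph) (S : {set G}).

Definition sub_adj : rel G := [rel x y | [&& x \in S, y \in S & adj x y]].

Lemma sub_adj_csym : connect_sym sub_adj.
Proof.
apply: sym_connect_sym => x y.
by rewrite /sub_adj /= adj_sym andbCA.
Qed.

(** Components stay subsets of [G], indexed by their canonical representative; the set is empty when
    [r] does not represent a vertex of [S]. *)
Definition comp_of (r : G) : {set G} := [set x in S | root sub_adj x == r].

Lemma comp_connected x : x \in S ->
  connected_graph (induced (comp_of (root sub_adj x))).
Proof.
move=> xS; set C := comp_of _.
have xC : x \in C by rewrite inE xS eqxx.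
split; first by apply/card_gt0P; exists (exist _ x xC).
have clo u v : u \in C -> sub_adj u v -> v \in C.
  rewrite !inE => /andP[uS /eqP<-] uv; have /and3P[_ vS _] := uv; rewrite vS /=.
  by rewrite (root_connect sub_adj_csym) sub_adj_csym connect1.
have lift p (u v : induced C) : path sub_adj (val u) p -> val v = last (val u) p ->
    connect (@adj (induced C)) u v.
  elim: p u => [|y p IH] u /=; first by move=> _ /val_inj->.
  move=> /andP[uy yp] Ev; have yC := clo _ _ (valP u) uy.
  apply: connect_trans (IH (exist _ y yC) yp Ev); apply: connect1.
  by have /and3P[] := uy.
move=> u v.
have /connectP[p] : connect sub_adj (val u) (val v); last exact: lift.
rewrite -(root_connect sub_adj_csym).
have := valP u; have := valP v; rewrite !inE => /andP[_ /eqP->] /andP[_ /eqP->] //.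
Qed.

Lemma sub_adj_root x y : x \in S -> y \in S -> adj x y ->
  root sub_adj x = root sub_adj y.
Proof.
move=> xS yS xy; apply/eqP; rewrite (root_connect sub_adj_csym) connect1 //.
by rewrite /sub_adj /= xS yS.
Qed.

End Components.

(** A clique in a neighbourhood extends by the apex. This lets the inductions on the clique number
    pass to neighbourhoods. *)
Lemma emb_complete_cone (G : sgraph) (x : G) (S : {set G}) k :
  (forall v, v \in S -> adj x v) ->
  emb (complete_graph k) (induced S) -> emb (complete_graph k.+1) G.
Proof.
move=> xS [f fI fA].
have xf i : adj x (val (f i)) := xS _ (valP (f i)).
apply: (emb_complete (h := fun i => if unlift ord0 i is Some j then val (f j) else x)).
move=> i j; case: unliftP => [i' ->|->]; case: unliftP => [j' ->|->] //.
- rewrite (inj_eq lift_inj) => ij; have := fA i' j'; rewrite /= /induced_adj /= => ->.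
  by rewrite /edge_rel /= andbT.
- by move=> _; rewrite adj_sym.
Qed.

Lemma complete0_emb (G : sgraph) : emb (complete_graph 0) G.
Proof.
have f (i : 'I_0) : G by case: i.
by apply: (emb_complete (h := f)) => -[].
Qed.

(** * Minimum sizes and stars as vertex sets *)

Lemma min_size_leq (T : finType) (P : {set {set T}} -> Prop) exP c :
  (exists2 C, P C & #|C| <= c) -> @min_size T P exP <= c.
Proof.
move=> [C PC cC]; rewrite /min_size; case: ex_minnP => k _ kmin.
by apply: leq_trans (kmin #|C| _) cC; apply/asboolP; exists C.
Qed.

Lemma min_size_attained (T : finType) (P : {set {set T}} -> Prop) exP :
  exists2 C, P C & #|C| = @min_size T P exP.
Proof.
by rewrite /min_size; case: ex_minnP => k /asboolP[C PC <-] _; exists C.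
Qed.

(** The exclusive or says that an edge has exactly one end at the centre; [K_1] and all the
    [K_{1,m}] are thus treated alike. *)
Definition star_at (G : sgraph) (S : {set G}) (c : G) : Prop :=
  c \in S /\ {in S &, forall x y, adj x y = (x == c) (+) (y == c)}.

Lemma star_setP (G : sgraph) (S : {set G}) :
  (exists2 H, star_family H & isomorphic (induced S) H) <-> exists c, star_at S c.
Proof.
split=> [[_ [->|[m _ ->]] [f [g fK gK] fA]]|[c [cS SA]]].
- exists (val (g ord0)); split=> [|x y xS yS]; first exact: valP.
  have all0 (z : induced S) : z = g ord0 by rewrite -(fK z) [f z]ord1.
  have E z (zS : z \in S) : z = val (g ord0) by rewrite -(all0 (exist _ z zS)).
  by rewrite (E _ xS) (E _ yS) adj_irr addbb.
- exists (val (g None)); split=> [|x y xS yS]; first exact: valP.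
  have := fA (exist _ x xS) (exist _ y yS); rewrite star_graph_adj => /esym.
  rewrite -[X in X = _]/(adj x y) => ->.
  have E z (zS : z \in S) : (f (exist _ z zS) == None) = (z == val (g None)).
    apply/eqP/eqP => [<-|Ez]; first by rewrite fK.
    by rewrite -[None]gK; congr f; exact: val_inj.
  by rewrite !E.
- have [S1|/card_gt0P[x xS]] := posnP #|S :\ c|.
    exists (complete_graph 1); first by left.
    have -> : S = [set c].
      apply/setP => x; rewrite inE; apply/idP/eqP => [xS|->//].
      apply/eqP; move/eqP: S1; rewrite cards_eq0 => /eqP/setP/(_ x).
      by rewrite !inE xS andbT => /negbFE.
    by apply: (@induced_set1 (complete_graph 1) (@ord0 0)) => h'; rewrite [h']ord1.
  exists (star_graph #|S :\ c|).
    by right; exists #|S :\ c| => //; apply/card_gt0P; exists x.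
  have vS (i : 'I_#|S :\ c|) : enum_val i \in S /\ enum_val i != c.
    by have := enum_valP i; rewrite !inE => /andP[].
  apply: (@induced_image (star_graph #|S :\ c|) _ (fun u : option 'I_#|S :\ c| =>
    if u is Some i then enum_val i else c)).
  + move=> [i|] [j|] //; first by move=> /enum_val_inj->.
      by move=> E; have [_] := vS i; rewrite E eqxx.
    by move=> E; have [_] := vS j; rewrite -E eqxx.
  + move=> [i|] [j|]; rewrite star_graph_adj.
    * have [iS /negbTE ic] := vS i; have [jS /negbTE jc] := vS j.
      by rewrite SA // ic jc.
    * by have [iS /negbTE ic] := vS i; rewrite SA // ic eqxx.
    * by have [jS /negbTE jc] := vS j; rewrite SA // jc eqxx.
    * by rewrite !adj_irr.
  + apply/setP => y; apply/imsetP/idP => [[[i|] _ ->]//|yS].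
      by case: (vS i).
    have [->|yc] := eqVneq y c; first by exists None.
    have yS' : y \in S :\ c by rewrite !inE yc.
    by exists (Some (enum_rank_in yS' y)); rewrite ?enum_rankK_in.
Qed.

(** * Covers and partitions by induced stars *)

Definition proper_coloring (G : sgraph) (K : Type) (f : G -> K) : Prop :=
  forall x y, adj x y -> f x <> f y.

(** No edge joins two components, so they can be coloured independently with the same colours. The
    value [None], taken on no vertex of [S], remains available for an apex. *)
Lemma comp_coloring (K : finType) (G : sgraph) (S : {set G}) :
  (forall x, x \in S -> exists f : induced (comp_of S (root (sub_adj S) x)) -> K,
     proper_coloring f) ->
  exists f : G -> option K, {in S, forall x, f x <> None} /\
    {in S &, forall x y, adj x y -> f x <> f y}.
Proof.
move=> Scol.
have /choice[g gP] r : exists g : G -> option K,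
    {in comp_of S r, forall x, g x <> None} /\
    {in comp_of S r &, forall x y, adj x y -> g x <> g y}.
  have [[x xS <-]|no] := pselect (exists2 x, x \in S & root (sub_adj S) x = r).
    have [f fP] := Scol x xS; exists (fun y => omap f (insub y)).
    split=> [y yC|y z yC zC yz]; first by rewrite insubT.
    by rewrite !insubT /= => -[]; exact: fP.
  have emp y : y \notin comp_of S r.
    by apply/negP; rewrite inE => /andP[yS /eqP yr]; apply: no; exists y.
  by exists (fun=> None); split=> [y yC|y z yC]; have := emp y; rewrite yC.
exists (fun x => g (root (sub_adj S) x) x); split=> [x xS|x y xS yS xy].
  by have [+ _] := gP (root (sub_adj S) x); apply; rewrite inE xS eqxx.
rewrite -(sub_adj_root xS yS xy).
have [_ +] := gP (root (sub_adj S) x); apply=> //; rewrite inE ?xS ?yS ?eqxx //=.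
by rewrite (sub_adj_root xS yS xy).
Qed.

(** The colour of [v] records its chosen dominating vertex [d v] and its colour in the neighbourhood
    of [d v], where the clique number is smaller. Vertices sharing [d v] lie in the closed
    neighbourhood of [d v], whose apex gets [None]. *)
Lemma chromatic k n : exists K : finType, forall G : sgraph, connected_graph G ->
  ~ emb (complete_graph k) G -> ~ emb (Sstar n) G -> ~ emb (path_graph n) G ->
  exists f : G -> K, proper_coloring f.
Proof.
elim: k => [|k [K HK]].
  by exists unit => G _ noK; case: noK; exact: complete0_emb.
have [c Hc] := dominating k.+1 n.
exists ('I_c * option K)%type => G cG noK noS noP.
have [X cX dX] := Hc G cG noK noS noP.
have /choice[d dP] v : exists x, x \in X /\ (v = x \/ adj x v).
  by have [vX|[x xX xv]] := dX v; [exists v; split; [|left]|exists x; split; [|right]].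
have /choice[g gP] x : exists g : G -> option K,
    {in [set v | adj x v], forall u, g u <> None} /\
    {in [set v | adj x v] &, forall u v, adj u v -> g u <> g v}.
  apply: comp_coloring => u ux; apply: HK; first exact: comp_connected.
  - by move=> /(emb_complete_cone (x := x)) H; apply: noK; apply: H => v; rewrite !inE => /andP[].
  - by move=> H; apply: noS; apply: emb_trans H (emb_induced _).
  - by move=> H; apply: noP; apply: emb_trans H (emb_induced _).
(* Recording the position of [d v] in [enum X], instead of [d v] itself, makes the type of colours
   independent of [G]. *)
have idx v : index (d v) (enum X) < c.
  apply: leq_trans cX; rewrite cardE index_mem mem_enum; by case: (dP v).
exists (fun v => (Ordinal (idx v), if v == d v then None else g (d v) v)).
move=> u v uv [] iuv.
have duv : d u = d v.
  have := congr1 (nth u (enum X)) iuv; rewrite !nth_index // mem_enum;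
    by [case: (dP u)|case: (dP v)].
have [gN gA] := gP (d v).
have [_ du] := dP u; have [_ dv] := dP v; rewrite duv in du *.
have [Eu|uN] := eqVneq u (d v); have [Ev|vN] := eqVneq v (d v).
- by move: uv; rewrite Eu -Ev adj_irr.
- by case: dv => [E|dv] /esym; [rewrite -E eqxx in vN|apply: gN; rewrite inE].
- by case: du => [E|du]; [rewrite E eqxx in uN|apply: gN; rewrite inE].
- case: du => [E|du]; first by rewrite E eqxx in uN.
  case: dv => [E|dv]; first by rewrite -E eqxx in vN.
  by apply: gA; rewrite ?inE.
Qed.

Lemma insc_bounded n : exists c, forall G : sgraph, connected_graph G ->
  ~ emb (complete_graph n) G -> ~ emb (Sstar n) G -> ~ emb (path_graph n) G ->
  insc G <= c.
Proof.
have [c Hc] := dominating n n; have [K HK] := chromatic n n.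
exists (c * #|K|) => G cG noK noS noP; apply: min_size_leq.
have [X cX dX] := Hc G cG noK noS noP; have [f fP] := HK G cG noK noS noP.
pose st (xk : G * K) := xk.1 |: [set v | adj xk.1 v & f v == xk.2].
exists (st @: setX X [set: K]); last first.
  apply: leq_trans (leq_imset_card _ _) _; rewrite cardsX cardsT.
  exact: leq_mul.
split=> [_ /imsetP[[x q] _ ->]|].
  apply/star_setP; exists x; split; first by rewrite !inE eqxx.
  have xNx u : adj x u -> (u == x) = false.
    by move=> xu; apply/eqP => E; rewrite E adj_irr in xu.
  move=> u v; rewrite !inE /= => /orP[/eqP->|/andP[xu fu]] /orP[/eqP->|/andP[xv fv]].
  - by rewrite adj_irr addbb.
  - by rewrite xv eqxx xNx.
  - by rewrite adj_sym xu eqxx xNx.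
  - rewrite !xNx //; apply/negP => /fP; apply.
    by rewrite (eqP fu) (eqP fv).
apply/setP => v; rewrite inE; apply/bigcupP.
have [vX|[x xX xv]] := dX v.
  exists (st (v, f v)); last by rewrite !inE eqxx.
  by apply: imset_f; rewrite !inE vX.
exists (st (x, f v)); last by rewrite !inE xv eqxx orbT.
by apply: imset_f; rewrite !inE xX.
Qed.

Definition star_partition (G : sgraph) (S : {set G}) q : Prop :=
  exists C : {set {set G}}, [/\ forall A, A \in C -> exists c, star_at A c,
    trivIset C, cover C = S & #|C| <= q].

Lemma star_partition_leq (G : sgraph) (S : {set G}) q q' :
  q <= q' -> star_partition S q -> star_partition S q'.
Proof. by move=> qq [C [*]]; exists C; split=> //; lia. Qed.

Lemma star_partition1 (G : sgraph) (S : {set G}) c : star_at S c -> star_partition S 1.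
Proof.
move=> Sc; exists [set S]; split; last by rewrite cards1.
- by move=> A; rewrite inE => /eqP->; exists c.
- by apply/trivIsetP => A B; rewrite !inE => /eqP-> /eqP->; rewrite eqxx.
- by rewrite /cover big_set1.
Qed.

Lemma star_partition_classes (G : sgraph) (K : finType) (h : G -> K)
    (S : {set G}) (I : {set K}) q :
  (forall x, x \in S -> h x \in I) ->
  (forall k, k \in I -> star_partition [set x in S | h x == k] q) ->
  star_partition S (#|I| * q).
Proof.
move=> hI Hq.
have /choice[C CP] k : exists C : {set {set G}}, k \in I ->
    [/\ forall A, A \in C -> exists c, star_at A c,
    trivIset C, cover C = [set x in S | h x == k] & #|C| <= q].
  have [/Hq[C CP]|_] := boolP (k \in I); first by exists C.
  by exists set0.
have inC k A x : k \in I -> A \in C k -> x \in A -> (x \in S) && (h x == k).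
  move=> kI AC xA; have [_ _ E _] := CP k kI.
  have : x \in cover (C k) by apply/bigcupP; exists A.
  by rewrite E inE.
exists (\bigcup_(k in I) C k); split.
- by move=> A /bigcupP[k kI AC]; have [+ _ _ _] := CP k kI; apply.
- apply/trivIsetP => A B /bigcupP[k kI AC] /bigcupP[l lI BC] AB.
  have [kl|kl] := eqVneq k l.
    by have [_ /trivIsetP + _ _] := CP k kI; apply=> //; rewrite kl.
  rewrite disjoint_subset; apply/subsetP => x xA; rewrite inE.
  apply/negP => xB; case/negP: kl.
  have /andP[_ /eqP<-] := inC _ _ _ kI AC xA.
  by have /andP[_ /eqP<-] := inC _ _ _ lI BC xB.
- apply/setP => x; apply/bigcupP/idP => [[A /bigcupP[k kI AC] xA]|xS].
    by have /andP[] := inC _ _ _ kI AC xA.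
  have [_ _ E _] := CP (h x) (hI x xS).
  have : x \in cover (C (h x)) by rewrite E inE xS eqxx.
  case/bigcupP=> A AC xA; exists A => //; apply/bigcupP; exists (h x) => //.
  exact: hI.
- by apply: card_bigcup_leq => k kI; have [] := CP k kI.
Qed.

Lemma star_partition_induced (G : sgraph) (S : {set G}) q :
  star_partition [set: induced S] q -> star_partition S q.
Proof.
move=> [C [CA CT CC Cq]].
have im (A : {set induced S}) u : (val u \in [set val x | x in A]) = (u \in A).
  by apply: mem_imset; exact: val_inj.
exists [set [set val u | u in A] | A : {set induced S} in C]; split.
- move=> _ /imsetP[A AC ->]; have [c [cA Ac]] := CA A AC.
  exists (val c); split; first by rewrite im.
  by move=> _ _ /imsetP[u uA ->] /imsetP[v vA ->]; rewrite !val_eqE -Ac.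
- apply/trivIsetP => _ _ /imsetP[A AC ->] /imsetP[B BC ->] AB.
  rewrite disjoint_subset; apply/subsetP => _ /imsetP[u uA ->]; rewrite inE im.
  have ABn : A != B by apply: contraNneq AB => ->.
  have /trivIsetP/(_ A B AC BC ABn) := CT.
  by rewrite disjoint_subset => /subsetP/(_ u uA).
- apply/setP => x; apply/bigcupP/idP => [[_ /imsetP[A AC ->] /imsetP[u _ ->]]|xS].
    exact: valP.
  have : exist _ x xS \in cover C by rewrite CC inE.
  case/bigcupP=> A AC xA; exists [set val u | u in A]; first exact: imset_f.
  by rewrite -[x]/(val (exist _ x xS : induced S)) im.
- exact: leq_trans (leq_imset_card _ _) Cq.
Qed.

(** The map [h] sends [x] and the isolated vertices [I] of [V] to [None], a single star, and every
    other vertex to its component. One edge from each of [n] nontrivial components would form, with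
    [x], an induced [Stilde n]. *)
Lemma star_partition_cone (G : sgraph) (x : G) (V : {set G}) n q :
  (forall v, v \in V -> adj x v) -> ~ emb (Stilde n) G ->
  (forall v, v \in V -> star_partition (comp_of V (root (sub_adj V) v)) q) ->
  star_partition (x |: V) (n.+1 * q.+1).
Proof.
move=> xV noS Hq.
pose I := [set v in V | [forall u in V, ~~ adj v u]].
have xNV : x \notin V by apply/negP => /xV; rewrite adj_irr.
pose r := root (sub_adj V).
pose h v := if (v == x) || (v \in I) then None else Some (r v).
pose R := [set r v | v in V :\: I].
have cR : #|R| <= n.
  rewrite leqNgt; apply/negP => /ltnW /subset_card[B BR Bn].
  have [b bI bB] := enum_inj Bn; apply: noS.
  have /choice[y yP] i : exists y, [/\ y \in V, y \notin I & r y = b i].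
    have /imsetP[y + ->] := subsetP BR _ (bB i).
    by rewrite inE => /andP[? ?]; exists y.
  have /choice[z zP] i : exists z, z \in V /\ adj (y i) z.
    have [yV + _] := yP i; rewrite inE yV /= => /forallPn[z].
    by rewrite negb_imply negbK => /andP[? ?]; exists z.
  have rz i : r (z i) = b i.
    have [yV _ <-] := yP i; have [zV yz] := zP i.
    by rewrite /r -(sub_adj_root yV zV yz).
  have sep u v i j : u \in V -> v \in V -> r u = b i -> r v = b j -> adj u v -> i = j.
    by move=> uV vV ui vj uv; apply: bI; rewrite -ui -vj; exact: sub_adj_root.
  have yV i : y i \in V by case: (yP i).
  have ry i : r (y i) = b i by case: (yP i).
  have zV i : z i \in V by case: (zP i).
  apply: (emb_Stilde (x := x) (y := y) (z := z)) => [i|i|i j|i j|i j].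
  - exact: xV.
  - exact: xV.
  - case: eqVneq => [<-|ij]; first by case: (zP i).
    by apply/negbTE; apply: contraNN ij => A; apply/eqP; apply: sep A.
  - have [->|ij] := eqVneq i j; first by rewrite adj_irr.
    by apply: contraNN ij => A; apply/eqP; apply: sep A.
  - have [->|ij] := eqVneq i j; first by rewrite adj_irr.
    by apply: contraNN ij => A; apply/eqP; apply: sep A.
(* There are at most [n.+1] classes: [None] and the components in [R]. The bound [q.+1] per class
   leaves room for the star at [x] even when [q = 0]. *)
apply: (@star_partition_leq _ _ (#|None |: [set Some k | k in R]| * q.+1)).
  rewrite leq_mul2r; apply/orP; right; apply: leq_trans (leq_card_setU _ _) _.
  by rewrite cards1 ltnS; apply: leq_trans (leq_imset_card _ _) cR.
apply: (@star_partition_classes _ _ h) => [v|[k|]].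
- rewrite !inE /h; case: eqVneq => //= vx vV.
  have [//|vI] := boolP (v \in I); rewrite /= imset_f //.
  by apply: imset_f; rewrite inE vI.
- rewrite !inE /= => /imsetP[k' /imsetP[v vVI ->] [->]].
  have /andP[vI vV] : (v \notin I) && (v \in V) by rewrite inE in vVI.
  apply: star_partition_leq (leqnSn q) _.
  have -> : [set u in x |: V | h u == Some (r v)] = comp_of V (r v); last exact: Hq.
  apply/setP => u; rewrite !inE /h.
  case: eqVneq => [->|ux] /=; first by rewrite (negPf xNV).
  case: (boolP (u \in V)) => // uV /=.
  case: ifP => uI; last by rewrite (inj_eq (@Some_inj _)).
  (* An isolated [u] is not in the component of another vertex [v]: the first step of a walk from
     [u] to [v] would be an edge at [u] inside [V]. *)
  apply/esym/negbTE/negP => /eqP rur.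
  have uv : u != v by apply: contraTneq uI => ->.
  have /connectP[s] : connect (sub_adj V) u v.
    by rewrite -(root_connect (@sub_adj_csym _ V)) rur.
  case: s => [|w s] /=; first by move=> _ E; rewrite E eqxx in uv.
  move=> /andP[/and3P[_ wV uw] _] _.
  by move: uI; rewrite inE => /andP[_ /forallP/(_ w)]; rewrite wV uw.
- move=> _; apply: (@star_partition_leq _ _ 1) => //.
  apply: (@star_partition1 _ _ x); split; first by rewrite !inE /h eqxx.
  have inN u : u \in [set v in x |: V | h v == None] -> u = x \/ (u \in I /\ u != x).
    rewrite inE => /andP[_]; rewrite /h; case: (eqVneq u x) => [->|ux]; first by left.
    by case: (boolP (u \in I)) => // uI _; right.
  have Ix u : u \in I -> adj x u by rewrite inE => /andP[/xV].
  move=> u v /inN[->|[uI ux]] /inN[->|[vI vx]].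
  + by rewrite adj_irr addbb.
  + by rewrite eqxx (negPf vx) Ix.
  + by rewrite eqxx (negPf ux) adj_sym Ix.
  + rewrite (negPf vx) (negPf ux); apply/negbTE.
    move: uI vI; rewrite !inE => /andP[_ /forallP/(_ v)] + /andP[vV _].
    by rewrite vV.
Qed.

Lemma star_partition_bounded k n : exists c, forall G : sgraph, connected_graph G ->
  ~ emb (complete_graph k) G -> ~ emb (Sstar n) G -> ~ emb (Stilde n) G ->
  ~ emb (path_graph n) G -> star_partition [set: G] c.
Proof.
elim: k => [|k [q Hq]].
  by exists 0 => G _ noK; case: noK; exact: complete0_emb.
have [c Hc] := dominating k.+1 n.
exists (c * (n.+1 * q.+1)) => G cG noK noS noT noP.
have [X cX dX] := Hc G cG noK noS noP.
(* Vertices of [X] are assigned to themselves, so the class of [x] is [x] together with some of its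
   neighbours outside [X], a cone with apex [x]. *)
have /choice[d dP] v : exists x, x \in X /\
    (if v \in X then v = x else adj x v).
  have [vX|] := boolP (v \in X); first by exists v.
  have [//|[x xX xv] _] := dX v; first by move=> ->.
  by exists x.
apply: (@star_partition_leq _ _ (#|X| * (n.+1 * q.+1))); first exact: leq_mul.
apply: (@star_partition_classes _ _ d) => [v _|x xX]; first by case: (dP v).
pose V := [set v | (v \notin X) && (d v == x)].
have -> : [set v in [set: G] | d v == x] = x |: V.
  apply/setP => v; rewrite !inE /=; have [_] := dP v.
  case: ifP => [vX <-|vX _]; first by rewrite /= orbF.
  by case: (eqVneq v x) => [E|//]; rewrite E xX in vX.
have xV v : v \in V -> adj x v.
  by rewrite inE => /andP[vX /eqP<-]; have [_] := dP v; rewrite (negPf vX).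
apply: star_partition_cone => // v vV; apply: star_partition_induced.
apply: Hq; first exact: comp_connected.
- move=> /(emb_complete_cone (x := x)) H; apply: noK; apply: H => u.
  by rewrite inE => /andP[/xV].
- by move=> H; apply: noS; apply: emb_trans H (emb_induced _).
- by move=> H; apply: noT; apply: emb_trans H (emb_induced _).
- by move=> H; apply: noP; apply: emb_trans H (emb_induced _).
Qed.

Lemma insp_bounded n : exists c, forall G : sgraph, connected_graph G ->
  ~ emb (complete_graph n) G -> ~ emb (Sstar n) G -> ~ emb (Stilde n) G ->
  ~ emb (path_graph n) G -> insp G <= c.
Proof.
have [c Hc] := star_partition_bounded n n; exists c => G cG noK noS noT noP.
have [C [CA CT CC Cc]] := Hc G cG noK noS noT noP.
apply: min_size_leq; exists C => //; split=> //; split=> // A AC.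
by apply/star_setP; exact: CA.
Qed.

(** * Neighbourhoods of long induced paths *)

Lemma F1_irr n : irreflexive (@F1_edge n).
Proof. by case=> [[[|[|a]] lt_a]|[i|i]] //=; lia. Qed.

Lemma F2_irr n : irreflexive (@F2_edge n).
Proof. by case=> [a|[i|i]] //=; lia. Qed.

Lemma F4_irr n : irreflexive (@F4_edge n).
Proof. by case=> [a|[i|i]] //=; lia. Qed.

Lemma F5_irr n : irreflexive (@F5_edge n).
Proof. by case=> [a|[i|i]] //=; rewrite ?eqxx //; lia. Qed.

(** The common part of the embeddings of [F1], [F2], [F4] and [F5]: both legs are induced paths, and
    only the adjacencies between different parts depend on the graph. *)
Lemma emb_xyz (G : sgraph) k n (e : rel (xyz k n)) (x : 'I_k -> G) (y z : nat -> G) :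
  irreflexive e -> injective x -> ipath y n -> ipath z n ->
  (forall i j, i < n -> j < n -> y i != z j) ->
  (forall a i, i < n -> (x a != y i) && (x a != z i)) ->
  (forall a b, adj (x a) (x b) = e (Xv a) (Xv b) || e (Xv b) (Xv a)) ->
  (forall a (i : 'I_n), adj (x a) (y i) = e (Xv a) (Yv i) || e (Yv i) (Xv a)) ->
  (forall a (i : 'I_n), adj (x a) (z i) = e (Xv a) (Zv i) || e (Zv i) (Xv a)) ->
  (forall i j : 'I_n, adj (y i) (z j) = e (Yv i) (Zv j) || e (Zv j) (Yv i)) ->
  (forall i j, e (Yv i) (Yv j) = (j == i.+1 :> nat)) ->
  (forall i j, e (Zv i) (Zv j) = (j == i.+1 :> nat)) ->
  emb (graph_of_edges e) G.
Proof.
move=> eI xI yP zP yz xyz xx xy xz ayz ey ez.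
have nyz (i j : 'I_n) : y i = z j -> False.
  by move/eqP; rewrite (negPf (yz _ _ _ _)).
have nxy a (i : 'I_n) : x a = y i -> False.
  by have /andP[/eqP] := xyz a i (ltn_ord i).
have nxz a (i : 'I_n) : x a = z i -> False.
  by have /andP[_ /eqP] := xyz a i (ltn_ord i).
exists (xyz_fun x (fun i : 'I_n => y i) (fun i : 'I_n => z i) : graph_of_edges e -> G).
  case=> [a|[i|i]] [b|[j|j]] //= E; try (exfalso; by eauto).
  - by rewrite (xI _ _ E).
  - by move/eqP: E; rewrite yP // => /eqP/val_inj->.
  - by move/eqP: E; rewrite zP // => /eqP/val_inj->.
move=> u v; rewrite edges_adj //.
case: u v => [a|[i|i]] [b|[j|j]] //=; rewrite ?xx ?xy ?xz ?ayz //.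
- by rewrite adj_sym xy orbC.
- by rewrite yP // !ey; lia.
- by rewrite adj_sym xz orbC.
- by rewrite adj_sym ayz orbC.
- by rewrite zP // !ez; lia.
Qed.

Definition pair_fun (T : Type) (x t : T) (a : 'I_2) : T := if a == 0 :> nat then x else t.

Lemma pair_fun_inj (T : eqType) (x t : T) : x != t -> injective (pair_fun x t).
Proof.
move=> xt [[|[|a]] ?] [[|[|b]] ?] //= E; apply: val_inj => //=.
  by rewrite /pair_fun /= in E; rewrite E eqxx in xt.
by rewrite /pair_fun /= in E; rewrite E eqxx in xt.
Qed.

Section Legs.
Variables (G : sgraph) (n : nat) (y z : nat -> G).
Hypotheses (yP : ipath y n) (zP : ipath z n).
Hypothesis yz : forall i j, i < n -> j < n -> y i != z j.

Lemma emb_F1 (x t : G) :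
  (forall i j, i < n -> j < n -> adj (y i) (z j) = false) ->
  (forall i, i < n -> ((x != y i) && (x != z i)) *
     (adj x (y i) = (i == 0)) * (adj x (z i) = (i == 0))) ->
  (forall i, i < n -> ((t != y i) && (t != z i)) *
     (adj t (y i) = false) * (adj t (z i) = false)) ->
  adj x t -> emb (F1 n) G.
Proof.
move=> ayz xP tP xt; have xNt : x != t by apply: contraTneq xt => ->; rewrite adj_irr.
apply: (emb_xyz (x := pair_fun x t) (y := y) (z := z)) => //.
- exact: F1_irr.
- exact: pair_fun_inj.
- by move=> [[|[|a]] ?] i im //=; rewrite /pair_fun /= ?xP ?tP.
- by move=> [[|[|a]] ?] [[|[|b]] ?] //=; rewrite /pair_fun /= ?adj_irr // adj_sym.
- by move=> [[|[|a]] ?] i //=; rewrite /pair_fun /= ?xP ?tP ?orbF.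
- by move=> [[|[|a]] ?] i //=; rewrite /pair_fun /= ?xP ?tP ?orbF.
- by move=> i j; rewrite ayz.
Qed.

Lemma emb_F2 (x : G) :
  (forall i j, i < n -> j < n -> adj (y i) (z j) = (i == 0) && (j == 0)) ->
  (forall i, i < n -> ((x != y i) && (x != z i)) *
     (adj x (y i) = (i == 0)) * (adj x (z i) = (i == 0))) ->
  emb (F2 n) G.
Proof.
move=> ayz xP; apply: (emb_xyz (x := fun=> x) (y := y) (z := z)) => //.
- exact: F2_irr.
- by move=> a b _; rewrite (ord1 a) (ord1 b).
- by move=> _ i im; rewrite xP.
- by move=> a b; rewrite adj_irr.
- by move=> a i; rewrite xP //= orbF.
- by move=> a i; rewrite xP //= orbF.
- by move=> i j; rewrite ayz //= orbF.
Qed.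

(** The two graphs differ only in the edge [x t], which decides the disjunct. *)
Lemma emb_F45 (x t : G) : x != t ->
  (forall i j, i < n -> j < n -> adj (y i) (z j) = false) ->
  (forall i, i < n -> ((x != y i) && (x != z i)) *
     (adj x (y i) = (i == 0)) * (adj x (z i) = (i == 0))) ->
  (forall i, i < n -> ((t != y i) && (t != z i)) *
     (adj t (y i) = (i == 0)) * (adj t (z i) = (i == 0))) ->
  emb (F4 n) G \/ emb (F5 n) G.
Proof.
move=> xNt ayz xP tP; case: (boolP (adj x t)) => xt; [right|left];
  apply: (emb_xyz (x := pair_fun x t) (y := y) (z := z)) => //.
1: exact: F5_irr. 7: exact: F4_irr.
1,7: exact: pair_fun_inj.
1,6: by move=> [[|[|a]] ?] i im //=; rewrite /pair_fun /= ?xP ?tP.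
- by move=> [[|[|a]] ?] [[|[|b]] ?] //=; rewrite /pair_fun /= ?adj_irr // adj_sym.
1,2,5,6: by move=> [[|[|a]] ?] i //=; rewrite /pair_fun /= ?xP ?tP ?orbF.
1,3: by move=> i j; rewrite ayz.
move=> [[|[|a]] ?] [[|[|b]] ?] //=; rewrite /pair_fun /= ?adj_irr // ?(negPf xt) //.
by rewrite adj_sym (negPf xt).
Qed.

End Legs.

(* No condition is imposed at j = i, so that p i itself belongs to the class. *)
Definition twin (G : sgraph) (p : nat -> G) (d i : nat) (w : G) : Prop :=
  forall j, j <= d -> j != i -> adj w (p j) = (i.+1 == j) || (j.+1 == i).

Definition replace (G : sgraph) (p : nat -> G) i w k := if k == i then w else p k.

Lemma replace_ipath (G : sgraph) (p : nat -> G) d w i : ipath p d.+1 -> 0 < i < d ->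
  twin p d i w -> ipath (replace p i w) d.+1.
Proof.
move=> pP id tw.
have wN k : k <= d -> k != i -> (w == p k) = false.
  move=> kd ki; apply/negbTE/eqP => E.
  have := tw i.+1; have := tw i.-1; rewrite E !pP; lia.
move=> k l km lm; rewrite /replace.
case: (eqVneq k i) => [->|ki]; case: (eqVneq l i) => [->|li].
- by rewrite !eqxx adj_irr; split; lia.
- by rewrite wN // tw //; split; lia.
- by rewrite eq_sym wN // adj_sym tw //; split; lia.
- by rewrite !pP.
Qed.

Section DeepNeighbours.
Variables (G : sgraph) (n D : nat).
Hypotheses (n_gt1 : 1 < n) (noF1 : ~ emb (F1 n) G) (noF2 : ~ emb (F2 n) G).
Hypothesis degD : forall v : G, #|[set u | adj v u]| <= D.

(** Room for at most [D] jumps of length at most [n.+1] between neighbours of a vertex, followed by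
    an empty window of length [n.+1]. *)
Definition margin := D.+1 * n.+1.

(** Move right from neighbour to neighbour of [w] while the next one is at most [n.+1] away. After
    [D] jumps [w] would have [D.+1] neighbours, so an empty window appears earlier. *)
Lemma gap_right (p : nat -> G) d w j : ipath p d.+1 -> adj w (p j) ->
  j + margin <= d -> exists b, [/\ j <= b, b + n.+1 <= j + margin, adj w (p b)
    & forall k, b < k -> k <= b + n.+1 -> adj w (p k) = false].
Proof.
move=> pP wj jd.
have claim t : forall j, adj w (p j) ->
    (exists b, [/\ j <= b, b <= j + t * n.+1, adj w (p b)
       & forall k, b < k -> k <= b + n.+1 -> adj w (p k) = false]) \/
    (exists s : seq nat, [/\ uniq s, size s = t.+1 &
       forall i, i \in s -> [/\ j <= i, i <= j + t * n.+1 & adj w (p i)]]).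
  elim: t => [|t IH] {wj jd}j wj.
    right; exists [:: j]; split=> // i; rewrite inE => /eqP->; split=> //; lia.
  have [[k [jk kj wk]]|no] := pselect (exists k, [/\ j < k, k <= j + n.+1 & adj w (p k)]).
    case: (IH k wk) => [[b [kb bk wb gb]]|[s [sU ss sP]]].
      by left; exists b; split=> //; lia.
    right; exists (j :: s); split=> /=; last 1 first.
    - move=> i; rewrite inE => /orP[/eqP->|/sP[? ? ?]]; split=> //; lia.
    - by rewrite sU andbT; apply/negP => /sP[]; lia.
    - by rewrite ss.
  left; exists j; split=> // [|k jk kj]; first lia.
  by apply/negP => wk; apply: no; exists k.
have [[b [jb bj wb gb]]|[s [sU ss sP]]] := claim D j wj.
  by exists b; split=> //; rewrite /margin; lia.
have sub : {subset map p s <= enum [set u | adj w u]}.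
  by move=> _ /mapP[i /sP[_ _ wi] ->]; rewrite mem_enum inE.
have mU : uniq (map p s).
  rewrite map_inj_in_uniq // => i k /sP[_ ri _] /sP[_ rk _] /eqP.
  by rewrite pP => [/eqP||] //; move: jd; rewrite /margin; lia.
have := uniq_leq_size mU sub; rewrite size_map -cardE ss.
by move/leq_trans => /(_ _ (degD w)); rewrite ltnn.
Qed.

Lemma gap_left (p : nat -> G) d w j : ipath p d.+1 -> adj w (p j) ->
  margin <= j -> j <= d -> exists a, [/\ a <= j, j + n.+1 <= a + margin, adj w (p a)
    & forall k, k < a -> a <= k + n.+1 -> adj w (p k) = false].
Proof.
move=> pP wj jm jd.
have [|||b [jb bj wb gb]] := @gap_right (fun k => p (d - k)) d w (d - j).
- exact: ipath_rev pP.
- by have -> : d - (d - j) = j by lia.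
- lia.
exists (d - b); split=> //; try lia.
move=> k kb bk; have := gb (d - k).
by have -> : d - (d - k) = k; [lia|apply; lia].
Qed.

(** Let [a <= j <= b] bound a cluster of neighbours of [w] with empty windows on both sides; the
    windows supply the legs of a forbidden graph unless [b = a + 2]. In that case [w] is a twin at
    [a + 1]. A vertex of [p] is its own twin. *)
Lemma deep_neighbour (p : nat -> G) d w j : ipath p d.+1 ->
  adj w (p j) -> margin <= j -> j + margin <= d ->
  exists i, [/\ j <= i.+1, i <= j.+1 & twin p d i w].
Proof.
move=> pP wj jm jd.
have [[k kd Ew]|wN] := pselect (exists2 k, k <= d & w = p k).
  rewrite {}Ew in wj *; exists k; move: wj; rewrite pP ?ltnS //; last lia.
  move=> kj; split; try lia.
  by move=> l ld lk; rewrite pP ?ltnS.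
have {}wN k : k <= d -> (w == p k) = false.
  by move=> kd; apply/negbTE/eqP => E; apply: wN; exists k.
have [b [jb bj wb gb]] := gap_right pP wj jd.
have [a [aj ja wa ga]] := gap_left pP wj jm (leq_trans (leq_addr _ _) jd).
have mD : n.+1 <= margin by rewrite /margin mulSn; lia.
have wA k : a <= k + n.+1 -> k <= b + n.+1 -> (k <= a) || (b <= k) ->
    adj w (p k) = (k == a) || (k == b).
  move=> ak kb; case: (ltngtP k a) => [ka _|ka|->] /=; last by rewrite wa.
    by rewrite ga //; lia.
  case: (ltngtP k b) => [//|bk _|->] /=; last by rewrite wb.
  by rewrite gb.
have ya m s : m <= s.+1 -> s <= d -> ipath (fun i => p (s - i)) m.
  by move=> ms sd i k im km; split; rewrite pP; lia.
have za m s : s + m <= d.+1 -> ipath (fun i => p (s + i)) m.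
  by move=> ms i k im km; split; rewrite pP; lia.
have zw m : m <= n -> a.+1 < b -> ipath (fun i => if i is i'.+1 then p (b + i') else w) m.
  move=> mn ab [|i] [|k] im km /=; split; rewrite ?eqxx ?adj_irr //;
    rewrite ?[_ == w]eq_sym ?wN ?[adj _ w]adj_sym ?wA ?pP; lia.
have ab : a <= b by lia.
case: (ltngtP b a.+1) => [ba|ba|Eb].
(* A single neighbour: [p a] is the centre of an [F1] with pendant vertex [w]. *)
- have {ba} Eb : b = a by lia.
  case: noF1; apply: (@emb_F1 _ _ (fun i => p (a.-1 - i)) (fun i => p (a.+1 + i))
    _ _ _ (p a) w); try (by [apply: ya; lia|apply: za; lia]).
  + by move=> i k im km; rewrite pP; lia.
  + by move=> i k im km; rewrite pP; lia.
  + by move=> i im; rewrite !pP; try lia; split; [split|]; lia.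
  + move=> i im; rewrite !wN; try lia; rewrite !wA; try lia.
    by split; [split|]; lia.
  + by rewrite adj_sym.
(* As [p a] and [p b] are not adjacent, [w] can be the centre of an [F1]; a neighbour beyond the
   windows would be its pendant vertex. *)
- have far c : c <= d -> (c + n.+1 < a) || (b + n.+1 < c) -> adj w (p c) = false.
    move=> cd cab; apply/negbTE/negP => wc; case: noF1.
    apply: (@emb_F1 _ _ (fun i => p (a - i)) (fun i => p (b + i))
      _ _ _ w (p c)) => //; try (by [apply: ya; lia|apply: za; lia]).
    + by move=> i k im km; rewrite pP; lia.
    + by move=> i k im km; rewrite pP; lia.
    + move=> i im; rewrite !wN; try lia; rewrite !wA; try lia.
      by split; [split|]; lia.
    + by move=> i im; rewrite !pP; try lia; split; [split|]; lia.
  have [Eb|ba2] := eqVneq b a.+2.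
    exists a.+1; split; try lia.
    move=> k kd ka; have [kn|kn] := boolP ((a <= k + n.+1) && (k <= b + n.+1)).
      by rewrite wA; lia.
    by rewrite far //; lia.
  (* Now [b > a + 2]. If [p a.+1] sees [w], then [p a], [p a.+1], [w] is the triangle of an [F2];
     otherwise [p a.+1] is the pendant vertex of an [F1] centred at [p a]. In both, one leg runs
     through [w] and [p b]. *)
  have [aw|aw] := boolP (adj (p a.+1) w).
    case: noF2.
    apply: (@emb_F2 _ _ (fun i => p (a - i))
      (fun i => if i is i'.+1 then p (b + i') else w) _ _ _ (p a.+1)).
    + by apply: ya; lia.
    + by apply: zw; lia.
    + by move=> i [|k] im km; rewrite 1?eq_sym ?wN ?pP; lia.
    + by move=> i [|k] im km; rewrite 1?[adj _ w]adj_sym ?wA ?pP; lia.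
    + move=> [|i] im; rewrite ?[_ == w]eq_sym ?wN ?aw ?pP;
        try lia; split; try split; lia.
  case: noF1.
  apply: (@emb_F1 _ _ (fun i => p (a.-1 - i))
    (fun i => if i is i'.+1 then p (b + i') else w) _ _ _ (p a) (p a.+1)).
  + by apply: ya; lia.
  + by apply: zw; lia.
  + by move=> i [|k] im km; rewrite 1?eq_sym ?wN ?pP; lia.
  + by move=> i [|k] im km; rewrite 1?[adj _ w]adj_sym ?wA ?pP; lia.
  + move=> [|i] im; rewrite ?[_ == w]eq_sym ?[adj _ w]adj_sym ?wN ?wa ?pP;
      try lia; split; try split; lia.
  + move=> [|i] im; rewrite ?[_ == w]eq_sym ?(negPf aw) ?wN ?pP;
      try lia; split; try split; lia.
  + by rewrite pP; lia.
(* Here [b = a + 1], and [w], [p a], [p b] form the triangle. *)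
- case: noF2; apply: (@emb_F2 _ _ (fun i => p (a - i)) (fun i => p (b + i)) _ _ _ w).
  + by apply: ya; lia.
  + by apply: za; lia.
  + by move=> i k im km; rewrite pP; lia.
  + by move=> i k im km; rewrite pP; lia.
  + move=> i im; rewrite !wN; try lia; rewrite !wA; try lia.
    by split; [split|]; lia.
Qed.

(** A neighbour at [j.+1] leaves the twin positions [j], [j.+1] and [j.+2]; the last two would
    require adjacency to [p j.+2] and [p j.+3] respectively. *)
Lemma twin_right (p : nat -> G) d w j : ipath p d.+1 ->
  margin <= j.+1 -> j.+1 + margin <= d -> adj w (p j.+1) ->
  adj w (p j.+2) = false -> adj w (p j.+3) = false -> twin p d j w.
Proof.
move=> pP jm jd w1 w2 w3; have [k [jk kj]] := deep_neighbour pP w1 jm jd.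
have mD : 2 < margin by rewrite /margin mulSn; lia.
have [->//|kNj] := eqVneq k j.
have [->|kNj1] := eqVneq k j.+1 => tw.
  by have := tw j.+2; rewrite w2; lia.
by have := tw j.+3; rewrite w3; lia.
Qed.

Lemma twin_left (p : nat -> G) d w j : ipath p d.+1 ->
  margin <= j.-1 -> j.-1 + margin <= d -> adj w (p j.-1) ->
  adj w (p j.-2) = false -> adj w (p (j - 3)) = false -> twin p d j w.
Proof.
move=> pP jm jd w1 w2 w3; have [k [jk kj]] := deep_neighbour pP w1 jm jd.
have mD : 2 < margin by rewrite /margin mulSn; lia.
have [->//|kNj] := eqVneq k j.
have [->|kNj1] := eqVneq k j.-1 => tw.
  by have := tw j.-2; rewrite w2; lia.
by have := tw (j - 3); rewrite w3; lia.
Qed.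

(** Replacing [p i] by [w] gives another induced path, on which [u] has a deep neighbour and hence
    is a twin at some [k]. Only the adjacency of [u] to [p i] remains unknown; it is recovered from
    positions on the other side of [k]. *)
Lemma twin_neighbour (p : nat -> G) d w i u : ipath p d.+1 ->
  margin + 4 <= i -> i + (margin + 4) <= d -> twin p d i w -> adj w u ->
  exists k, [/\ i <= k.+1, k <= i.+1 & twin p d k u].
Proof.
move=> pP im id tw wu; have := replace_ipath pP _ tw => /(_ ltac:(lia)) qP.
have [|||k [ik ki tk]] := @deep_neighbour _ d u i qP; try lia.
  by rewrite /replace eqxx adj_sym.
exists k; split=> //.
have rE l : l != i -> replace p i w l = p l by rewrite /replace => /negPf->.
have tkE l : l <= d -> l != k -> l != i -> adj u (p l) = (k.+1 == l) || (l.+1 == k).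
  by move=> ld lk li; rewrite -(rE l) // tk.
have [E|kNi] := eqVneq k i; first by move=> l ld lk; apply: tkE => //; rewrite -E.
have [E|kNi1] := eqVneq k i.+1.
  by apply: twin_right => //; rewrite ?tkE; lia.
by apply: twin_left => //; rewrite ?tkE; lia.
Qed.

(** The positions to the right of [j] that certify [v] as a twin are unaffected when [w] replaces
    [p i]. So [v] is a twin at [j] for the new path as well, and its adjacency to [w] is read off at
    position [i]. *)
Lemma twin_transversal (p : nat -> G) d i j w v : ipath p d.+1 ->
  margin + 4 <= i -> i < j -> j + (margin + 4) <= d ->
  twin p d i w -> twin p d j v -> (w == v) = false /\ adj w v = (i.+1 == j).
Proof.
move=> pP im ij jd tw tv; split.
  by apply/negbTE/eqP => E; have := tw j.+1; have := tv j.+1; rewrite E; lia.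
have := replace_ipath pP _ tw => /(_ ltac:(lia)) qP.
have rE l : l != i -> replace p i w l = p l by rewrite /replace => /negPf->.
have : twin (replace p i w) d j v.
  by apply: twin_right => //; rewrite ?rE ?tv; lia.
by move=> /(_ i); rewrite /replace eqxx adj_sym => ->; lia.
Qed.

End DeepNeighbours.

(** * The tube around a longest induced path *)

Section Tube.
Variables (G : sgraph) (n D : nat) (p : nat -> G) (d : nat).
Hypotheses (n_gt1 : 1 < n) (noF1 : ~ emb (F1 n) G) (noF2 : ~ emb (F2 n) G).
Hypothesis degD : forall v : G, #|[set u | adj v u]| <= D.
Hypothesis connG : connected_graph G.
Hypothesis pP : ipath p d.+1.
Hypothesis p_longest : forall q m, @ipath G q m -> m <= d.+1.

Definition tube_margin := margin n D + 5.
Notation M := tube_margin.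
Hypothesis d_big : 2 * M + 2 * n + 5 < d.

Definition tube : {set G} :=
  [set w | `[< exists i, [/\ M <= i, i + M <= d & twin p d i w] >]].

Lemma twin_self i : i <= d -> twin p d i (p i).
Proof. by move=> id j jd ji; rewrite pP. Qed.

Let E : {set G} := [set p i | i : 'I_M] :|: [set p (d - i) | i : 'I_M].

Let ends_index i : i <= d -> (i < M) || (d < i + M) -> p i \in E.
Proof.
move=> id; rewrite inE => /orP[iM|iM]; apply/orP; [left|right].
  by apply/imsetP; exists (Ordinal iM).
have iM' : d - i < M by lia.
apply/imsetP; exists (Ordinal iM') => //=.
by have -> : d - (d - i) = i by lia.
Qed.

Let endsP u : u \in E -> exists2 i, u = p i & (i <= d) && ((i < M) || (d < i + M)).
Proof.
rewrite inE => /orP[]/imsetP[i _ ->]; have := ltn_ord i.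
  by exists i => //; lia.
by exists (d - i) => //; lia.
Qed.

(** The sources from which the complement of the tube is layered; [E] consists of the two end
    segments of [p]. *)
Let A0 : {set G} :=
  [set u | (u \notin tube) && ((u \in E) || [exists v in E, adj v u])].

Let near u i : u \notin tube -> i <= d -> (i < M) || (d < i + M) ->
  adj u (p i) -> u \in A0.
Proof.
move=> uW id iM ui; rewrite inE uW /=; apply/orP; right; apply/existsP.
by exists (p i); rewrite ends_index // adj_sym.
Qed.

(** Outside the tube [k] can only be the first position beyond either border, and then the neighbour
    of [u] one step further out lies in [E]. *)
Let twin_near u k : u \notin tube -> M <= k.+1 -> k + M <= d.+1 ->
  twin p d k u -> u \in A0 /\ ((k.+1 == M) || (k + M == d.+1)).
Proof.
move=> uW kM kd tk.
have kend : (k.+1 == M) || (k + M == d.+1).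
  apply/negPn/negP => kN; case/negP: uW; rewrite inE; apply/asboolP.
  by exists k; split=> //; lia.
split=> //; have M5 : 5 <= M by rewrite /M; lia.
have [E1|E1] := eqVneq k.+1 M.
  by apply: (near (i := k.-1)) => //; try lia; rewrite tk; lia.
by apply: (near (i := k.+1)) => //; try lia; rewrite tk; lia.
Qed.

Let deep_near u i : u \notin tube -> M <= i -> i + M <= d -> adj u (p i) ->
  u \in A0 /\ ((i == M) || (i + M == d)).
Proof.
move=> uW iM id ui; have MM : margin n D <= M by rewrite /M; lia.
have [||k [ik ki tk]] := deep_neighbour n_gt1 noF1 noF2 degD pP ui; try lia.
have [||uA kM] := twin_near uW _ _ tk; try lia.
Qed.

Let e : rel G := [rel x y | [&& x \notin tube, y \notin tube & adj x y]].

Let ball_notin k x : x \in ball e A0 k -> x \notin tube.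
Proof.
case: k => [|k]; first by rewrite inE => /andP[].
elim: k.+1 => [|l IH]; first by rewrite inE => /andP[].
rewrite inE => /orP[/IH//|]; rewrite inE => /existsP[y /andP[_]].
by move=> /and3P[].
Qed.

(** A neighbour of a tube vertex is a twin at a nearby position, so it is in the tube or in [A0].
    Hence a walk leaving the tube always re-enters the complement through [A0]. *)
Let reach u : u \in tube \/ exists k, u \in ball e A0 k.
Proof.
move: u; apply: (connected_closed connG (r := p 0)).
  have [W0|W0] := boolP (p 0 \in tube); [by left|right; exists 0].
  by rewrite inE W0 ends_index // /M; lia.
move=> x y xP xy; have [yW|yW] := boolP (y \in tube); [by left|right].
have [xW|xW] := boolP (x \in tube).
  exists 0; move: xW; rewrite inE => /asboolP[i [iM id ti]].
  have [||k [ik ki tk]] := twin_neighbour n_gt1 noF1 noF2 degD pP _ _ ti xy;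
    try (rewrite /M in iM id *; lia).
  by have [||] := twin_near yW _ _ tk; try lia.
case: xP => [|[k xk]]; first by rewrite (negPf xW).
by exists k.+1; apply: ball_step xk _; rewrite /e /= xW yW.
Qed.

(** A longer geodesic [q] starts at a vertex [w] attached to the ends of [p]. If [w] sees both ends,
    it is the centre of an [F1] with pendant vertex [q 1]; if it sees only one, replacing the part
    of [p] beyond [w] by [q] gives an induced path longer than [p]. *)
Let layer_bound r u : u \in layer e A0 r -> r <= M.
Proof.
move=> ur; rewrite leqNgt; apply/negP => rM.
have M5 : 5 <= M by rewrite /M; lia.
have [q [qr ql qe]] := layer_path ur.
have qW i : i <= r -> q i \notin tube.
  by move=> ir; apply: ball_notin (subsetP (layer_ball _ _ _) _ (ql i ir)).
have qP : ipath q r.+1.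
  by apply: layer_ipath ql qe _ => i j ir jr _; rewrite /e /= !qW.
have qA i : 0 < i -> i <= r -> q i \notin A0.
  by move=> i0 ir; apply: layer_notin_ball i0 (ql i ir).
have deepW k : k <= d -> (k < M) || (d < k + M) = false -> p k \in tube.
  by move=> kd kM; rewrite inE; apply/asboolP; exists k; split; [lia|lia|exact: twin_self].
have qN i k : 0 < i -> i <= r -> k <= d -> (q i == p k) = false /\ adj (q i) (p k) = false.
  move=> i0 ir kd; have qiA := qA i i0 ir; have qiW := qW i ir; split.
    apply/negbTE/eqP => Eq; case kM : ((k < M) || (d < k + M)).
      by case/negP: qiA; rewrite inE qiW Eq ends_index.
    by case/negP: qiW; rewrite Eq deepW.
  apply/negbTE/negP => qk; case/negP: qiA; case kM : ((k < M) || (d < k + M)).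
    exact: near qk.
  by have [||] := deep_near qiW _ _ qk; try lia.
pose w := q 0.
have wW : w \notin tube by apply: qW.
have wE : w \notin E.
  (* If [w] were in [E], its neighbour [q 1] would already belong to [A0]. *)
  apply/negP => wE; have /negP := qA 1 isT ltac:(lia); apply.
  rewrite inE qW /=; last lia; apply/orP; right; apply/existsP; exists w.
  by rewrite wE; have /and3P[] := qe 0 ltac:(lia).
have wN k : k <= d -> (w == p k) = false.
  move=> kd; apply/negbTE/eqP => Eq; case kM : ((k < M) || (d < k + M)).
    by case/negP: wE; rewrite Eq ends_index.
  by case/negP: wW; rewrite Eq deepW.
have wmid k : M < k -> k + M < d -> adj w (p k) = false.
  move=> kM kd; apply/negbTE/negP => wk.
  by have [||_] := deep_near wW _ _ wk; lia.
have [e0 we0 e0P] : exists2 i, adj w (p i) & (i <= d) && ((i < M) || (d < i + M)).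
  have := ql 0 isT; rewrite inE (negPf wE) /= => /andP[_ /existsP[v /andP[/endsP[i -> iP]]]].
  by exists i; rewrite // adj_sym.
pose L k := (k <= M) && adj w (p k).
pose R k := [&& d <= k + M, k <= d & adj w (p k)].
have maxL : (exists k, L k) -> exists j, L j /\ forall k, L k -> k <= j.
  move=> exL; have ub k : L k -> k <= M by move=> /andP[].
  by case: (ex_maxnP exL ub) => j Lj jmax; exists j.
have minR : (exists k, R k) -> exists j, R j /\ forall k, R k -> j <= k.
  by move=> exR; case: (ex_minnP exR) => j Rj jmin; exists j.
have [exL|noL] := pselect (exists k, L k); have [exR|noR] := pselect (exists k, R k).
(* The innermost neighbours [j] and [j'] on the two sides start the legs, which run towards the
   middle of [p], where [w] has no neighbour. *)
- have [j [/andP[jM wj] jmax]] := maxL exL.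
  have [j' [/and3P[j'M j'd wj'] jmin]] := minR exR.
  case: noF1; apply: (@emb_F1 _ _ (fun i => p (j + i)) (fun i => p (j' - i))
    _ _ _ w (q 1)).
  + by move=> i k im km; split; rewrite pP; lia.
  + by move=> i k im km; split; rewrite pP; lia.
  + by move=> i k im km; rewrite pP; lia.
  + by move=> i k im km; rewrite pP; lia.
  + move=> i im; rewrite !wN; try lia; split; [split=> //|].
      have [->|i0] := posnP i; first by rewrite addn0 wj.
      have [iM|iM] := leqP (j + i) M; last by rewrite wmid; lia.
      by apply/negbTE/negP => wi; have := jmax (j + i); rewrite /L iM wi; lia.
    have [->|i0] := posnP i; first by rewrite subn0 wj'.
    have [iM|iM] := leqP d (j' - i + M); last by rewrite wmid; lia.
    by apply/negbTE/negP => wi; have := jmin (j' - i); rewrite /R iM wi; lia.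
  + move=> i im; have [|||E1 E2] := @qN 1 (j + i); try lia.
    have [|||E3 E4] := @qN 1 (j' - i); try lia.
    by rewrite E1 E2 E3 E4.
  + by have /and3P[] := qe 0 ltac:(lia).
(* The new path runs from [p d] down to [p j] and then along [q]. It gains [r.+1] vertices and loses
   only [j <= M < r]. *)
- have [j [/andP[jM wj] jmax]] := maxL exL.
  have : ipath (fun k => if k < (d - j).+1 then p (d - k) else q (k - (d - j).+1))
      ((d - j).+1 + r.+1).
    apply: (@ipath_cat _ (fun k => p (d - k)) q) => //.
      by move=> i k im km; split; rewrite pP; lia.
    move=> i [|k] im km; last first.
      have [|||E1 E2] := @qN k.+1 (d - i); try lia.
      by rewrite eq_sym E1 adj_sym E2; split=> //; lia.
    split; first by rewrite eq_sym wN //; lia.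
    rewrite adj_sym -/w.
    have [Ei|iN] := eqVneq i (d - j).
      by have -> : d - i = j; [lia|rewrite wj Ei eqxx].
    have -> : (i.+1 == (d - j).+1) && (0 == 0) = false by lia.
    apply/negbTE/negP => wi.
    have [iM|iM] := leqP (d - i) M.
      by have := jmax (d - i); rewrite /L iM wi; lia.
    have [dM|dM] := leqP d (d - i + M); last by rewrite wmid in wi; lia.
    by apply: noR; exists (d - i); rewrite /R dM wi; lia.
  by move/p_longest; lia.
- have [j [/and3P[jM jd wj] jmin]] := minR exR.
  have : ipath (fun k => if k < j.+1 then p k else q (k - j.+1)) (j.+1 + r.+1).
    apply: (@ipath_cat _ p q) => //; first by apply: ipath_le pP; lia.
    move=> i [|k] im km; last first.
      have [|||E1 E2] := @qN k.+1 i; try lia.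
      by rewrite eq_sym E1 adj_sym E2; split=> //; lia.
    split; first by rewrite eq_sym wN //; lia.
    rewrite adj_sym -/w.
    have [Ei|iN] := eqVneq i j; first by rewrite Ei wj eqxx.
    have -> : (i.+1 == j.+1) && (0 == 0) = false by lia.
    apply/negbTE/negP => wi.
    have [iM|iM] := leqP d (i + M).
      by have := jmin i; rewrite /R iM wi; lia.
    have [dM|dM] := leqP i M; last by rewrite wmid in wi; lia.
    by apply: noL; exists i; rewrite /L dM wi.
  by move/p_longest; lia.
- have [e0M|e0M] := leqP e0 M; first by apply: noL; exists e0; rewrite /L e0M.
  by apply: noR; exists e0; rewrite /R we0; lia.
Qed.

(** The factors come from the [2 * M] vertices bounding [E], one step from [E] to [A0], and at most
    [M] further layers, all with degrees at most [D]. *)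
Lemma tube_complement : #|~: tube| <= D.+1 ^ M * (D.+1 * (2 * M)).
Proof.
have sub : ~: tube \subset ball e A0 M.
  apply/subsetP => u; rewrite inE => uW; have [|[k]] := reach u.
    by rewrite (negPf uW).
  case/ball_layer=> l _ ul.
  apply: subsetP (ball_mono _ _ (layer_bound ul)) _ _.
  exact: subsetP (layer_ball _ _ _) _ ul.
apply: leq_trans (subset_leq_card sub) _.
have eD x : #|[set y | e x y]| <= D.
  apply: leq_trans (degD x); apply: subset_leq_card; apply/subsetP => y.
  by rewrite !inE => /and3P[].
apply: leq_trans (ball_card _ _ eD) _; rewrite leq_mul2l; apply/orP; right.
have sub0 : A0 \subset ball (@adj G) E 1.
  by apply/subsetP => u; rewrite !inE => /andP[].
apply: leq_trans (subset_leq_card sub0) _.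
apply: leq_trans (ball_card _ _ degD) _; rewrite expn1 leq_mul2l; apply/orP; right.
apply: leq_trans (leq_card_setU _ _) _; rewrite mul2n -addnn.
by apply: leq_add; apply: leq_trans (leq_imset_card _ _) _; rewrite card_ord.
Qed.

End Tube.

(** * Covers and partitions by induced paths *)

Lemma degree_bound n : exists D, forall G : sgraph,
  ~ emb (complete_graph n) G -> ~ emb (star_graph n) G ->
  forall v : G, #|[set u | adj v u]| <= D.
Proof.
have [R HR] := ramsey n n; exists R => G noK noS v.
rewrite leqNgt; apply/negP => /ltnW/(HR _ _ (@adj_sym G))[[B [_ Bn BC]]|[B [BA Bn BI]]].
  have [h hI hB] := enum_inj Bn; apply: noK.
  by apply: (emb_complete (h := h)) => i j ij; apply: BC; rewrite // (inj_eq hI).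
have [h hI hB] := enum_inj Bn; apply: noS.
apply: (emb_star (x := v) hI) => [i|i j].
  by have := subsetP BA _ (hB i); rewrite inE.
have [->|ij] := eqVneq i j; first by rewrite adj_irr.
by apply: BI; rewrite // (inj_eq hI).
Qed.

Lemma longest_ipath (G : sgraph) : 0 < #|G| -> exists (p : nat -> G) (d : nat),
  ipath p d.+1 /\ forall q m, @ipath G q m -> m <= d.+1.
Proof.
move=> /card_gt0P[x _].
have ex : exists m, `[< exists q, @ipath G q m >].
  exists 1; apply/asboolP; exists (fun=> x) => i j; rewrite !ltnS !leqn0.
  by move=> /eqP-> /eqP->; rewrite !eqxx adj_irr.
have ub m : `[< exists q, @ipath G q m >] -> m <= #|G|.
  by move=> /asboolP[q]; exact: ipath_card.
case: (ex_maxnP ex ub) => m /asboolP[p pP] mmax.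
have m1 : 0 < m.
  apply: mmax; apply/asboolP; exists (fun=> x) => i j; rewrite !ltnS !leqn0.
  by move=> /eqP-> /eqP->; rewrite !eqxx adj_irr.
exists p, m.-1; rewrite prednK //; split=> // q l qP.
by apply: mmax; apply/asboolP; exists q.
Qed.

(** The set [T i] is the twin class of position [M + i] of a longest induced path. Covers and
    partitions by paths are both read off from this structure. *)
Lemma tubular n : 1 < n -> exists c, forall G : sgraph, connected_graph G ->
  ~ emb (complete_graph n) G -> ~ emb (star_graph n) G ->
  ~ emb (F1 n) G -> ~ emb (F2 n) G ->
  exists (l : nat) (T : nat -> {set G}),
  [/\ #|~: \bigcup_(i < l) T i| <= c,
      forall i, i < l -> 0 < #|T i| <= c,
      forall q, (forall i, i < l -> q i \in T i) -> ipath q l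
    & ~ emb (F4 n) G -> ~ emb (F5 n) G -> forall i, i < l -> #|T i| <= 1].
Proof.
move=> n1; have [D HD] := degree_bound n.
set M := tube_margin n D; pose d0 := 2 * M + 2 * n + 5.
(* The summands bound, in turn, a graph whose induced paths are all short, the complement of the
   tube, and a twin class. *)
exists (D.+1 ^ d0 + D.+1 ^ M * (D.+1 * (2 * M)) + D) => G cG noK noS noF1 noF2.
have degD := HD G noK noS.
have [p [d [pP plong]]] := longest_ipath (proj1 cG).
have [dd|dd] := leqP d d0.
  (* Geodesics are induced paths, so [G] has bounded radius and degree, hence bounded order; no
     class is used. *)
  exists 0, (fun=> set0); split=> //.
    have cG' : #|G| <= D.+1 ^ d0.
      have sub : [set: G] \subset ball (@adj G) [set p 0] d0.
        apply/subsetP => u _; have [k uk] := connected_layer (p 0) u cG.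
        have [q [_ ql qe]] := layer_path uk.
        have : ipath q k.+1 by apply: layer_ipath ql qe _.
        move/plong; rewrite ltnS => kd.
        apply: subsetP (ball_mono _ _ (leq_trans kd dd)) _ _.
        exact: subsetP (layer_ball _ _ _) _ uk.
      rewrite -cardsT; apply: leq_trans (subset_leq_card sub) _.
      by apply: leq_trans (ball_card _ _ degD) _; rewrite cards1 muln1.
    by apply: leq_trans (max_card _) _; lia.
have M5 : margin n D + 5 = M by [].
pose T i := [set w | `[< twin p d (M + i) w >]].
exists (d - (2 * M)).+1, T.
have TP i w : w \in T i -> twin p d (M + i) w by rewrite inE => /asboolP.
have tubeT : tube n D p d = \bigcup_(i < (d - (2 * M)).+1) T i.
  apply/setP => w; rewrite inE; apply/asboolP/bigcupP => [[i [iM id ti]]|[i _ wi]].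
    have lti : i - M < (d - 2 * M).+1 by rewrite -/M in iM id; lia.
    exists (Ordinal lti) => //; rewrite inE; apply/asboolP => /=.
    by have -> : M + (i - M) = i by rewrite -/M in iM; lia.
  exists (M + i); have := ltn_ord i => lti; split; last exact: TP.
    by rewrite -/M; lia.
  by rewrite -/M; lia.
split.
- rewrite -tubeT; have := tube_complement n1 noF1 noF2 degD cG pP plong dd.
  by rewrite -/M; lia.
- move=> i il; apply/andP; split.
    apply/card_gt0P; exists (p (M + i)); rewrite inE; apply/asboolP.
    by apply: twin_self pP _ _; lia.
  have sub : T i \subset [set u | adj (p (M + i).+1) u].
    by apply/subsetP => u /TP tu; rewrite inE adj_sym tu; lia.
  by apply: leq_trans (subset_leq_card sub) _; have := degD (p (M + i).+1); lia.
- move=> q qT.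
  have tr i j : i < j -> j < (d - 2 * M).+1 ->
      (q i == q j) = false /\ adj (q i) (q j) = (i.+1 == j).
    move=> ij jl; have ti := TP _ _ (qT i (ltn_trans ij jl)); have tj := TP _ _ (qT j jl).
    have [|||-> ->] := twin_transversal n1 noF1 noF2 degD pP _ _ _ ti tj; lia.
  move=> i j il jl; case: (ltngtP i j) => [ij|ji|->].
  + by have [-> ->] := tr i j ij jl; split; lia.
  + by have [E1 E2] := tr j i ji il; rewrite eq_sym E1 adj_sym E2; split; lia.
  + by rewrite eqxx adj_irr; split; lia.
(* A second member [w] of the class of [p (M + i)] would give an [F4] or an [F5], whose legs are the
   two directions of the path. *)
- move=> noF4 noF5 i il.
  have -> : T i = [set p (M + i)]; last by rewrite cards1.
  apply/setP => w; apply/idP/set1P => [/TP tw|->]; last first.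
    by rewrite inE; apply/asboolP; apply: twin_self pP _ _; lia.
  apply/eqP; rewrite eq_sym; apply/negPn/negP => wp.
  have := replace_ipath pP _ tw => /(_ ltac:(lia)) qP.
  have wN k : k <= d -> k != M + i -> (w == p k) = false.
    move=> kd ki; have [+ _] := qP (M + i) k ltac:(lia) ltac:(lia).
    by rewrite /replace eqxx (negPf ki) => ->; lia.
  have nM : n.+1 <= M by rewrite -M5 /margin mulSn; lia.
  have [] // := @emb_F45 G n (fun k => p ((M + i).-1 - k)) (fun k => p ((M + i).+1 + k))
    _ _ _ (p (M + i)) w wp.
  + by move=> k j km jm; split; rewrite pP; lia.
  + by move=> k j km jm; split; rewrite pP; lia.
  + by move=> k j km jm; rewrite pP; lia.
  + by move=> k j km jm; rewrite pP; lia.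
  + by move=> k km; rewrite !pP; try lia; split; [split|]; lia.
  + move=> k km; rewrite !wN; try lia; rewrite !tw; try lia.
    by split; [split|]; lia.
Qed.

Lemma path_set1 (G : sgraph) (x : G) :
  exists2 H, path_family H & isomorphic (induced [set x]) H.
Proof.
exists (path_graph 1); first by exists 1.
by apply: (@induced_set1 (path_graph 1) (@ord0 0)) => h'; rewrite [h']ord1.
Qed.

Lemma inpc_bounded n : 1 < n -> exists c, forall G : sgraph, connected_graph G ->
  ~ emb (complete_graph n) G -> ~ emb (star_graph n) G ->
  ~ emb (F1 n) G -> ~ emb (F2 n) G -> inpc G <= c.
Proof.
move=> /tubular[c Hc]; exists (c + c) => G cG noK noS noF1 noF2.
have [l [T [cZ cT TP _]]] := Hc G cG noK noS noF1 noF2.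
apply: min_size_leq; set Z := ~: _ in cZ.
have [x0 _] := card_gt0P (proj1 cG).
(* The transversal [q t] takes the [t]-th member of each class, or the first one if the class is too
   small; so [c] transversals cover all classes. *)
pose q (t i : nat) := nth (nth x0 (enum (T i)) 0) (enum (T i)) t.
have qT t i : i < l -> q t i \in T i.
  move=> il; rewrite -mem_enum /q; have [tT|tT] := ltnP t (size (enum (T i))).
    exact: mem_nth.
  by rewrite nth_default // mem_nth // -cardE; case/andP: (cT i il).
(* For [l = 0] the transversal would be empty, which is not a path of the family. *)
pose C1 := if 0 < l then [set [set q t i | i : 'I_l] | t : 'I_c] else set0.
exists (C1 :|: [set [set z] | z in Z]); last first.
  apply: leq_trans (leq_card_setU _ _) _; apply: leq_add.
    rewrite /C1; case: ifP => _; last by rewrite cards0.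
    by apply: leq_trans (leq_imset_card _ _) _; rewrite card_ord.
  exact: leq_trans (leq_imset_card _ _) cZ.
split=> [S|].
  rewrite inE => /orP[|/imsetP[z _ ->]]; last exact: path_set1.
  rewrite /C1; case: ifP => l0; last by rewrite inE.
  move=> /imsetP[t _ ->].
  exists (path_graph l); first by exists l.
  by apply: ipath_iso; apply: TP => i; exact: qT.
apply/setP => u; rewrite inE; apply/bigcupP.
have [uZ|] := boolP (u \in Z).
  exists [set u]; last by rewrite inE.
  by rewrite inE; apply/orP; right; apply: imset_f.
rewrite inE negbK => /bigcupP[i _ ui]; have il := ltn_ord i.
have ut : index u (enum (T i)) < size (enum (T i)) by rewrite index_mem mem_enum.
have utc : index u (enum (T i)) < c.
  by apply: leq_trans ut _; rewrite -cardE; case/andP: (cT i il).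
exists [set q (index u (enum (T i))) j | j : 'I_l]; last first.
  by apply/imsetP; exists i => //; rewrite /q nth_index // mem_enum.
rewrite inE; apply/orP; left; rewrite /C1 (leq_ltn_trans _ il) //.
by apply/imsetP; exists (Ordinal utc).
Qed.

Lemma inpp_bounded n : 1 < n -> exists c, forall G : sgraph, connected_graph G ->
  ~ emb (complete_graph n) G -> ~ emb (star_graph n) G ->
  ~ emb (F1 n) G -> ~ emb (F2 n) G -> ~ emb (F4 n) G -> ~ emb (F5 n) G ->
  inpp G <= c.
Proof.
move=> /tubular[c Hc]; exists (1 + c) => G cG noK noS noF1 noF2 noF4 noF5.
have [l [T [cZ cT TP T1]]] := Hc G cG noK noS noF1 noF2.
apply: min_size_leq; set Z := ~: _ in cZ.
have [x0 _] := card_gt0P (proj1 cG).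
have /choice[q qT] i : exists x, i < l -> T i = [set x].
  case: (ltnP i l) => il; last by exists x0.
  have /eqP/cards1P[x ->] : #|T i| = 1.
    by have := cT i il; have := T1 noF4 noF5 i il; lia.
  by exists x.
have qP : ipath q l by apply: TP => i il; rewrite qT // inE.
pose S0 := [set q i | i : 'I_l].
have S0Z : Z = ~: S0.
  congr (~: _); apply/setP => u; apply/bigcupP/imsetP => -[i _].
    by rewrite qT // inE => /eqP->; exists i.
  by move=> ->; exists i; rewrite // qT // inE.
pose C1 := if 0 < l then [set S0] else set0.
exists (C1 :|: [set [set z] | z in Z]); last first.
  apply: leq_trans (leq_card_setU _ _) _; apply: leq_add.
    by rewrite /C1; case: ifP; rewrite ?cards0 ?cards1.
  exact: leq_trans (leq_imset_card _ _) cZ.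
have C1P S : S \in C1 -> S = S0 /\ 0 < l.
  by rewrite /C1; case: ifP; rewrite !inE // => _ /eqP->.
split; first split=> [S|].
- rewrite inE => /orP[/C1P[-> l0]|/imsetP[z _ ->]]; last exact: path_set1.
  by exists (path_graph l); [exists l|exact: ipath_iso].
- apply/setP => u; rewrite inE; apply/bigcupP.
  have [uZ|] := boolP (u \in Z).
    exists [set u]; last by rewrite inE.
    by rewrite inE; apply/orP; right; apply: imset_f.
  rewrite S0Z inE negbK => uS; exists S0 => //.
  have /imsetP[i _ _] := uS; have il := ltn_ord i.
  by rewrite inE; apply/orP; left; rewrite /C1 (leq_ltn_trans _ il) // inE.
- have dis z : z \in Z -> [disjoint [set z] & S0].
    by rewrite S0Z inE disjoints1.
  apply/trivIsetP => A B; rewrite !inE.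
  move=> /orP[/C1P[-> _]|/imsetP[z zZ ->]] /orP[/C1P[-> _]|/imsetP[z' z'Z ->]].
  + by rewrite eqxx.
  + by move=> _; rewrite disjoint_sym; exact: dis.
  + by move=> _; exact: dis.
  + by move=> zz; rewrite disjoints1 inE; apply: contraNN zz => /eqP->.
Qed.

(** * Lower bounds *)

Lemma connected_from (G : sgraph) (r : G) :
  (forall x, connect (@adj G) r x) -> connected_graph G.
Proof.
move=> rP; split; first by apply/card_gt0P; exists r.
move=> x y; apply: connect_trans (rP y).
by rewrite (sym_connect_sym (@adj_sym G)).
Qed.

Lemma connect_iter (G : sgraph) (f : nat -> G) m :
  (forall i, i.+1 < m -> adj (f i) (f i.+1)) ->
  forall i, i < m -> connect (@adj G) (f 0) (f i).
Proof.
move=> fA; elim=> [|i IH] im //; apply: connect_trans (IH (ltnW im)) _.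
by apply: connect1; exact: fA.
Qed.

Lemma complete_adj n (i j : 'I_n) : adj (i : complete_graph n) j = (i != j).
Proof. by rewrite /= /edge_rel /= andbT. Qed.

Lemma complete_connected n : 0 < n -> connected_graph (complete_graph n).
Proof.
case: n => // n _; apply: (@connected_from _ (ord0 : complete_graph n.+1)) => x.
have [->|xN] := eqVneq x (ord0 : complete_graph n.+1); first exact: connect0.
by apply: connect1; rewrite complete_adj eq_sym.
Qed.

Lemma star_connected n : connected_graph (star_graph n).
Proof.
apply: (@connected_from _ (None : star_graph n)) => -[i|]; last exact: connect0.
by apply: connect1; rewrite star_graph_adj.
Qed.

Lemma path_connected n : 0 < n -> connected_graph (path_graph n).
Proof.
case: n => // n _; apply: (@connected_from _ (inord 0 : path_graph n.+1)) => x.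
rewrite -(inord_val x).
apply: (@connect_iter _ (fun i => inord i : path_graph n.+1) n.+1) => // i im.
by rewrite path_graph_adj !inordK; lia.
Qed.

Lemma Sstar_connected n : connected_graph (Sstar n).
Proof.
have xy i : adj (Xv ord0 : Sstar n) (Yv i) by rewrite edges_adj //; exact: Sstar_irr.
apply: (@connected_from _ (Xv ord0 : Sstar n)) => -[a|[i|i]].
- by rewrite (ord1 a); exact: connect0.
- by apply: connect1.
- apply: connect_trans (connect1 (xy i)) _; apply: connect1.
  by rewrite edges_adj /= ?eqxx //; exact: Sstar_irr.
Qed.

Lemma Stilde_connected n : connected_graph (Stilde n).
Proof.
apply: (@connected_from _ (Xv ord0 : Stilde n)) => -[a|[i|i]].
- by rewrite (ord1 a); exact: connect0.
- by apply: connect1; rewrite edges_adj //; exact: Stilde_irr.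
- by apply: connect1; rewrite edges_adj //; exact: Stilde_irr.
Qed.

(** [E S] is the part of [Z] charged to [S]: below it is either [S :&: Z] or the set of ends of a
    path. *)
Lemma cover_count (T : finType) (C : {set {set T}}) (Z : {set T})
    (E : {set T} -> {set T}) b :
  (forall S, S \in C -> #|E S| <= b) ->
  (forall z, z \in Z -> exists2 S, S \in C & z \in E S) -> #|Z| <= #|C| * b.
Proof.
move=> Eb ZE; apply: leq_trans (card_bigcup_leq Eb).
by apply: subset_leq_card; apply/subsetP => z /ZE[S SC zS]; apply/bigcupP; exists S.
Qed.

Lemma cover_mem (T : finType) (C : {set {set T}}) : cover C = [set: T] ->
  forall z, exists2 S, S \in C & z \in S.
Proof.
move=> CT z; have /bigcupP[S SC zS] : z \in cover C by rewrite CT inE.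
by exists S.
Qed.

Lemma insc_leq_insp G : insc G <= insp G.
Proof.
rewrite /insp; have [C [CA _] <-] := min_size_attained (star_partition_exists G).
by apply: min_size_leq; exists C.
Qed.

Lemma inpc_leq_inpp G : inpc G <= inpp G.
Proof.
rewrite /inpp; have [C [CA _] <-] := min_size_attained (path_partition_exists G).
by apply: min_size_leq; exists C.
Qed.

Lemma insc_count (G : sgraph) (Z : {set G}) b :
  (forall S c, star_at S c -> #|S :&: Z| <= b) -> #|Z| <= insc G * b.
Proof.
move=> Hb; rewrite /insc.
have [C [CA CT] <-] := min_size_attained (cover_exists (star_partition_exists G)).
apply: (@cover_count _ _ _ (fun S => S :&: Z)) => [S /CA/star_setP[c]|z zZ].
  exact: Hb.
by have [S SC zS] := cover_mem CT z; exists S; rewrite // inE zS.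
Qed.

Lemma insc_complete n : n <= insc (complete_graph n) * 2.
Proof.
rewrite -{1}[n]card_ord -cardsT.
apply: (@insc_count (complete_graph n) [set: 'I_n]) => S c [cS SA].
rewrite setIT (cardsD1 c S) cS ltnS; apply/card_le1_eqP => x y.
rewrite !inE => /andP[xc xS] /andP[yc yS].
have := SA x y xS yS; rewrite complete_adj (negPf xc) (negPf yc) /=.
by move/negbFE/eqP.
Qed.

Lemma insc_path n : n <= insc (path_graph n) * 3.
Proof.
rewrite -{1}[n]card_ord -cardsT.
apply: (@insc_count (path_graph n) [set: 'I_n]) => S c [cS SA].
have sub : S \subset c |: ([set x : 'I_n | c.+1 == x] :|: [set x : 'I_n | x.+1 == c]).
  apply/subsetP => x xS; rewrite !inE; have := SA c x cS xS.
  by rewrite path_graph_adj eqxx; case: (x == c).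
rewrite setIT; apply: leq_trans (subset_leq_card sub) _.
have le1 : #|[set x : 'I_n | c.+1 == x]| <= 1.
  apply/card_le1_eqP => x y; rewrite !inE => /eqP Ex /eqP Ey.
  by apply: val_inj; rewrite /= -Ex -Ey.
have le2 : #|[set x : 'I_n | x.+1 == c]| <= 1.
  apply/card_le1_eqP => x y; rewrite !inE => /eqP Ex /eqP Ey.
  by apply: val_inj; apply: succn_inj; rewrite /= Ex Ey.
apply: leq_trans (leq_card_setU _ _) _; rewrite cards1.
apply: (@leq_add 1 _ 1 2) => //; apply: leq_trans (leq_card_setU _ _) _.
exact: (leq_add le1 le2).
Qed.

(** The vertices [z_i] are pairwise non-adjacent and have no common neighbours, so a star contains
    at most one of them. *)
Lemma insc_Sstar n : n <= insc (Sstar n).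
Proof.
pose zv (i : 'I_n) : Sstar n := Zv i.
have zI : injective zv by move=> i j [].
rewrite -[insc _]muln1 -{1}[n]card_ord -cardsT -(card_imset _ zI).
apply: insc_count => S c [cS SA]; apply/card_le1_eqP => u v.
move=> /setIP[iS /imsetP[i _ Ei]] /setIP[jS /imsetP[j _ Ej]]; subst.
have := SA _ _ iS jS; have := SA _ _ iS cS; have := SA _ _ jS cS.
have [//|ij] := eqVneq (zv i) (zv j).
rewrite !edges_adj; try exact: Sstar_irr.
rewrite eqxx; case: (eqVneq (zv i) c) => [Ec|ic]; case: (eqVneq (zv j) c) => [Ec'|jc] //=.
  by rewrite Ec Ec' eqxx in ij.
case: c {cS SA ic jc} => [a|[k|k]] //= /eqP-> /eqP E _.
by rewrite /zv E.
Qed.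

(** The star [S0] containing [x_1] misses [y_i] or [z_i] for each [i], because of the triangle. The
    missed vertices [v i] are pairwise non-adjacent with [x_1] as only common neighbour, so the
    other, disjoint stars contain at most one each. *)
Lemma insp_Stilde n : n <= insp (Stilde n).
Proof.
rewrite /insp.
have [C [[CA CT] Ctriv] <-] := min_size_attained (star_partition_exists (Stilde n)).
have [S0 S0C xS0] := cover_mem CT (Xv ord0 : Stilde n).
have /star_setP[c0 [c0S S0A]] := CA S0 S0C.
pose zv (i : 'I_n) : Stilde n := Zv i.
pose yv (i : 'I_n) : Stilde n := Yv i.
have yzS0 i : ~~ ((yv i \in S0) && (zv i \in S0)).
  apply/negP => /andP[yS zS].
  have := S0A _ _ yS zS; have := S0A _ _ yS xS0; have := S0A _ _ zS xS0.
  rewrite !edges_adj; try exact: Stilde_irr.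
  rewrite /= eqxx /=; case: (_ == c0); case: (_ == c0); by case: (_ == c0).
pose v i := if yv i \in S0 then zv i else yv i.
have vS0 i : v i \notin S0.
  by rewrite /v; case: ifP => [yS|/negbT//]; have := yzS0 i; rewrite yS.
have vI : injective v.
  by move=> i j; rewrite /v; case: ifP => _; case: ifP => _ [].
have vadj i j : i != j -> adj (v i) (v j) = false.
  move=> ij; rewrite edges_adj; last exact: Stilde_irr.
  by rewrite /v; case: ifP => _; case: ifP => _ //=; rewrite ?orbF; apply/negbTE; rewrite // eq_sym.
rewrite -[#|C|]muln1 -{1}[n]card_ord -cardsT -(card_imset _ vI).
apply: (@cover_count _ _ _ (fun S => S :&: v @: [set: 'I_n])) => [S SC|z zZ]; last first.
  by have [S SC zS] := cover_mem CT z; exists S; rewrite // inE zS.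
have /star_setP[c [cS SA]] := CA S SC.
apply/card_le1_eqP => u u' /setIP[iS /imsetP[i _ Ei]] /setIP[jS /imsetP[j _ Ej]]; subst.
have [->//|ij] := eqVneq i j; exfalso.
have xS : (Xv ord0 : Stilde n) \notin S.
  apply/negP => xS; have [SS|SS] := eqVneq S S0; first by have := vS0 i; rewrite -SS iS.
  have /trivIsetP/(_ S S0 SC S0C SS) := Ctriv.
  by rewrite disjoint_subset => /subsetP/(_ _ xS); rewrite inE xS0.
have vij : v i != v j by rewrite (inj_eq vI).
have := SA _ _ iS jS; have := SA _ _ iS cS; have := SA _ _ jS cS.
rewrite vadj // eqxx; case: (eqVneq (v i) c) => [Ec|ic]; case: (eqVneq (v j) c) => [Ec'|jc] //=.
  by rewrite Ec Ec' eqxx in vij.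
move=> jc' ic' _; case: c {SA ic jc} cS jc' ic' => [a|k].
  by rewrite (ord1 a) (negPf xS).
have vE l : exists b : bool, v l = if b then yv l else zv l.
  by rewrite /v; case: ifP => _; [exists false|exists true].
have := vE i; have := vE j => -[b ->] [b' ->] _.
case: k => k; case: b; case: b' => /andP[_ /= jk] /andP[_ /= ik] //;
  by move: jk ik ij; rewrite ?orbF => /eqP-> /eqP->; rewrite eqxx.
Qed.

(** An inner vertex has its predecessor and its successor as non-adjacent neighbours; [E] collects
    the ends. *)
Lemma path_ends (G : sgraph) (S : {set G}) m :
  isomorphic (induced S) (path_graph m) ->
  exists E : {set G}, #|E| <= 2 /\ forall v, v \in S -> v \notin E ->
    exists a b, [/\ a \in S, b \in S, adj v a, adj v b & (a != b) && ~~ adj a b].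
Proof.
move=> [f [g fK gK] fA].
have gA (i j : 'I_m) : adj (val (g i)) (val (g j)) = (i.+1 == j) || (j.+1 == i).
  by rewrite -path_graph_adj -{2}(gK i) -{2}(gK j) fA.
pose I := [set i : 'I_m | (i == 0 :> nat)] :|: [set i : 'I_m | i == m.-1 :> nat].
exists [set val (g i) | i in I]; split.
  apply: leq_trans (leq_imset_card _ _) _.
  have le1 k : #|[set i : 'I_m | i == k :> nat]| <= 1.
    apply/card_le1_eqP => x y; rewrite !inE => /eqP Ex /eqP Ey.
    by apply: val_inj; rewrite /= Ex Ey.
  by apply: leq_trans (leq_card_setU _ _) _; exact: (leq_add (le1 0) (le1 m.-1)).
move=> v vS vE; pose i : 'I_m := f (exist _ v vS).
have vi : v = val (g i) by rewrite fK.
have iI : i \notin I by apply: contraNN vE => iI; apply/imsetP; exists i.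
have im := ltn_ord i.
have [i0 i1] : 0 < i /\ i.+1 < m by move: iI; rewrite !inE; lia.
have lt1 : i.-1 < m by lia.
exists (val (g (Ordinal lt1))), (val (g (Ordinal i1))); rewrite vi.
split; try exact: valP; rewrite ?gA /=; try lia.
rewrite val_eqE (inj_eq (can_inj gK)) -val_eqE /=; lia.
Qed.

Lemma path_noC4 (G : sgraph) (S : {set G}) m x y u v :
  isomorphic (induced S) (path_graph m) ->
  x \in S -> y \in S -> u \in S -> v \in S -> x != y -> u != v ->
  adj x u -> adj x v -> adj y u -> adj y v -> False.
Proof.
move=> [f [g fK gK] fA] xS yS uS vS xy uv.
pose F z (zS : z \in S) : 'I_m := f (exist _ z zS).
have E a b (aS : a \in S) (bS : b \in S) :
    adj a b = ((F a aS).+1 == F b bS) || ((F b bS).+1 == F a aS).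
  by rewrite -path_graph_adj fA.
have N a b (aS : a \in S) (bS : b \in S) : a != b -> F a aS != F b bS :> nat.
  by apply: contraNneq => /val_inj/(can_inj fK)/(congr1 val)/= ->.
have := N _ _ xS yS xy; have := N _ _ uS vS uv.
rewrite (E _ _ xS uS) (E _ _ xS vS) (E _ _ yS uS) (E _ _ yS vS); lia.
Qed.

Lemma path_cover_ends (G : sgraph) (C : {set {set G}}) :
  (forall S, S \in C -> exists2 H, path_family H & isomorphic (induced S) H) ->
  exists E : {set G} -> {set G}, forall S, S \in C ->
    #|E S| <= 2 /\ forall v, v \in S -> v \notin E S ->
    exists a b, [/\ a \in S, b \in S, adj v a, adj v b & (a != b) && ~~ adj a b].
Proof.
move=> CA; have /choice[E EP] S : exists E : {set G}, S \in C ->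
    #|E| <= 2 /\ forall v, v \in S -> v \notin E ->
    exists a b, [/\ a \in S, b \in S, adj v a, adj v b & (a != b) && ~~ adj a b].
  have [/CA[_ [m _ ->]]|_] := boolP (S \in C); last by exists set0.
  by move/path_ends => [E EP]; exists E.
by exists E.
Qed.

(** A vertex whose neighbours are pairwise adjacent can only be an end of an induced path, and a
    path has at most two ends. *)
Lemma inpc_simplicial (G : sgraph) (Z : {set G}) :
  (forall v a b, v \in Z -> adj v a -> adj v b -> a != b -> adj a b) ->
  #|Z| <= inpc G * 2.
Proof.
move=> Zs; rewrite /inpc.
have [C [CA CT] <-] := min_size_attained (cover_exists (path_partition_exists G)).
have [E EP] := path_cover_ends CA.
apply: (@cover_count _ _ _ E) => [S /EP[]//|z zZ].
have [S SC zS] := cover_mem CT z; exists S => //.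
apply/negPn/negP => zE; have [_ /(_ z zS zE)[a [b [_ _ za zb /andP[ab]]]]] := EP S SC.
by rewrite (Zs z).
Qed.

Lemma inpc_complete n : n <= inpc (complete_graph n) * 2.
Proof.
rewrite -{1}[n]card_ord -cardsT.
apply: (@inpc_simplicial (complete_graph n) [set: 'I_n]) => v a b _ _ _.
by rewrite complete_adj.
Qed.

Lemma inpc_star n : n <= inpc (star_graph n) * 2.
Proof.
have sI : injective (Some : 'I_n -> option 'I_n) by move=> i j [].
rewrite -{1}[n]card_ord -cardsT -(card_imset _ sI).
apply: (@inpc_simplicial (star_graph n)) => _ a b /imsetP[i _ ->].
by rewrite !star_graph_adj; case: a b => [a|] [b|].
Qed.

(** * Long paths with many attached vertices *)

Definition attach (aL aM aR : bool) (i c : nat) : bool :=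
  [|| aL && (i.+1 == c), aM && (i == c) | aR && (i == c.+1)].

Lemma attach_near aL aM aR i c : attach aL aM aR i c -> i <= c.+1 /\ c <= i.+1.
Proof. by case/or3P => /andP[_ /eqP]; lia. Qed.

Lemma step_near i c : (i == c.+1) || (c == i.+1) -> i <= c.+1 /\ c <= i.+1.
Proof. by case/orP=> /eqP; lia. Qed.

Lemma near_sides c i j : 0 < c -> i <= c.+1 -> c <= i.+1 -> j <= c.+1 -> c <= j.+1 ->
  i != j -> ~~ ((j == i.+1) || (i == j.+1)) ->
  (i = c.-1 /\ j = c.+1) \/ (j = c.-1 /\ i = c.+1).
Proof.
move=> c0 i1 i2 j1 j2 /eqP ij; rewrite negb_or => /andP[/eqP n1 /eqP n2].
by case: (ltngtP i j) => ?; [left|right|]; lia.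
Qed.

Section Gadgets.
Variables (aL aM aR : bool) (n m : nat).

Definition gap := (2 * n).+3.
(** The middle of the [k]-th block of [gap] positions; distinct centres are too far apart for a
    connected graph on at most [n] vertices to meet two gadgets. *)
Definition centre (k : nat) := k * gap + n.+1.

(* A path on m * gap vertices, with the k-th extra vertex attached around
   position centre k: on its left, middle and right according to the booleans. *)
Definition gadget_edge (u v : 'I_(m * gap) + 'I_m) : bool :=
  match u, v with
  | inl i, inl j => j == i.+1 :> nat
  | inr k, inl i => attach aL aM aR i (centre k)
  | _, _ => false
  end.

Definition gadget : sgraph := graph_of_edges gadget_edge.

Lemma gadget_irr : irreflexive gadget_edge.
Proof. by case=> [i|k] //=; lia. Qed.

Lemma gadget_adj (u v : gadget) : adj u v = gadget_edge u v || gadget_edge v u.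
Proof. exact: edges_adj gadget_irr. Qed.

(** With extra vertices placed at their centre, positions change by at most one along an edge. *)
Definition gpos (u : gadget) : nat :=
  match u with inl i => i | inr k => centre k end.

Lemma gpos_lip u v : adj u v -> gpos u <= (gpos v).+1.
Proof.
rewrite gadget_adj /attach; case: u v => [i|k] [j|l] //=; rewrite /attach;
  by case: aL aM aR => [] [] []; lia.
Qed.

Lemma centre_lt (k : 'I_m) : (centre k).+1 < m * gap.
Proof. by have := ltn_ord k; rewrite /centre /gap; nia. Qed.

Lemma centre_inj k l : centre k < centre l + n -> centre l < centre k + n -> k = l.
Proof. by rewrite /centre /gap; nia. Qed.

Lemma gadget_connected : 0 < m -> aM || aR -> connected_graph gadget.
Proof.
move=> m0 aMR.
have L0 : 0 < m * gap by rewrite /gap; nia.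
pose f i : gadget := inl (insubd (Ordinal L0) i).
have fv i : i < m * gap -> val (insubd (Ordinal L0) i) = i.
  by move=> im; rewrite val_insubd im.
have fP : forall i, i < m * gap -> connect (@adj gadget) (f 0) (f i).
  apply: connect_iter => i im; rewrite gadget_adj /= !fv //; last lia.
  by rewrite eqxx.
apply: (@connected_from _ (f 0)) => -[i|k].
  have -> : inl i = f i by rewrite /f; congr inl; apply: val_inj; rewrite fv.
  exact: fP.
have := centre_lt k => ck.
pose j := if aM then centre k else (centre k).+1.
have jL : j < m * gap by rewrite /j; case: aM => //; lia.
apply: connect_trans (fP j jL) _; apply: connect1.
rewrite gadget_adj /= fv // /attach /j; case: aM aMR => [_|/= ->].
  by rewrite eqxx !orbT.
by rewrite eqxx !orbT.
Qed.

(** A single gadget on an unbounded path: [Some i] is position [i], and [None] is the extra vertex,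
    attached around position [n]. *)
Definition model_adj (u v : option nat) : bool :=
  match u, v with
  | Some i, Some j => (i.+1 == j) || (j.+1 == i)
  | None, Some i | Some i, None => attach aL aM aR i n
  | None, None => false
  end.

(** The copy of [H] spans fewer than [n] positions, so it meets at most one extra vertex; a
    translation moves the centre of that vertex to [n]. *)
Lemma gadget_local (H : sgraph) : connected_graph H -> #|H| <= n -> emb H gadget ->
  exists2 g : H -> option nat, injective g /\
    (forall x y, model_adj (g x) (g y) = adj x y)
    & forall x i, g x = Some i -> 0 < i < 2 * n.
Proof.
move=> [/card_gt0P[h _] cH] Hn [f fI fA].
have dist x y : gpos (f x) < gpos (f y) + n.
  have /connectP[s sp ->] := cH x y; case: (shortenP sp) => s' sp' sU _.
  have ss : size s' < n.
    by apply: leq_trans Hn; have /card_uniqP /= <- := sU; exact: max_card.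
  apply: (@leq_ltn_trans (gpos (f (last x s')) + size s')); last by rewrite ltn_add2l.
  elim: s' x sp' {sU sp ss} => [|u s' IH] x /=; first lia.
  move=> /andP[xu /IH le1].
  have le2 : gpos (f x) <= (gpos (f u)).+1 by apply: gpos_lip; rewrite fA.
  by apply: leq_trans le2 _; rewrite addnS ltnS.
(* [x0] is mapped to the extra vertex if one occurs; otherwise any vertex of [H] serves as the
   origin. *)
have [x0 x0P] : exists x0, forall x k, f x = inr k -> centre k = gpos (f x0).
  have [[x0 [k fx0]]|no] := pselect (exists x0 k, f x0 = inr k).
    exists x0 => x l fx; have := dist x x0; have := dist x0 x; rewrite fx fx0 /=.
    by move=> d1 d2; rewrite (centre_inj d1 d2).
  by exists h => x k fx; case: no; exists x, k.
set c := gpos (f x0) in x0P.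
have rng x i : f x = inl i -> c < i + n /\ i < c + n.
  by move=> fx; have := dist x x0; have := dist x0 x; rewrite fx /=.
pose g x := match f x with inl i => Some (i + n - c) | inr _ => None end.
exists g; last first.
  move=> x i; rewrite /g; case fx : (f x) => [j|//] [<-].
  by have := rng _ _ fx; lia.
split=> [x y|x y]; rewrite /g.
  case fx : (f x) => [i|k]; case fy : (f y) => [j|l] //.
    have := rng _ _ fx; have := rng _ _ fy => ? ? -[E].
    by apply: fI; rewrite fx fy; congr inl; apply: val_inj => /=; lia.
  move=> _; apply: fI; rewrite fx fy; congr inr; apply: val_inj => /=.
  have := x0P _ _ fx; have := x0P _ _ fy => E1 E2.
  have H0 : 0 < #|H| by apply/card_gt0P; exists x.
  by apply: centre_inj; rewrite E1 E2; lia.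
rewrite -fA gadget_adj; case fx : (f x) => [i|k]; case fy : (f y) => [j|l] //=.
- by have := rng _ _ fx; have := rng _ _ fy; lia.
- have := rng _ _ fx; have := x0P _ _ fy => -> ?.
  by rewrite /attach; case: aL aM aR => [] [] []; lia.
- have := rng _ _ fy; have := x0P _ _ fx => -> ?.
  by rewrite orbF /attach; case: aL aM aR => [] [] []; lia.
Qed.

Lemma model_emb (X H : sgraph) (psi : X -> option nat) :
  (forall u v, adj u v = model_adj (psi u) (psi v)) ->
  (exists u, psi u = None) -> (forall i, 0 < i < 2 * n -> exists u, psi u = Some i) ->
  connected_graph H -> #|H| <= n -> emb H gadget -> emb H X.
Proof.
move=> psiA psiN psiS cH Hn /(gadget_local cH Hn)[g [gI gA] gS].
have /choice[f fP] x : exists u, psi u = g x.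
  by case gx : (g x) => [i|] //; apply: psiS; exact: gS gx.
exists f; last by move=> x y; rewrite psiA !fP gA.
by move=> x y E; apply: gI; rewrite -!fP E.
Qed.

(** An extra vertex sees only its centre and possibly the next position, which are adjacent; hence
    it is simplicial. *)
Lemma inpc_gadget : ~~ aL -> aM -> m <= inpc gadget * 2.
Proof.
move=> aL0 aM1; pose w (k : 'I_m) : gadget := inr k.
have wI : injective w by move=> k l [].
rewrite -{1}[m]card_ord -cardsT -(card_imset _ wI).
apply: inpc_simplicial => _ a b /imsetP[k _ ->]; rewrite !gadget_adj /w.
case: a b => [i|l] [j|l'] //=; rewrite !orbF /attach (negPf aL0) aM1 /= => wi wj ij.
have {}ij : i != j :> nat by apply: contraNneq ij => /val_inj->.
by move: wi wj; case: aR; lia.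
Qed.

(** The extra vertex [w k] and the centre [z k] both see [l k] and [r k]. For each [k] one of [w k],
    [z k] is an end of its path: otherwise disjointness would put all four vertices into one path,
    which has no 4-cycle. *)
Lemma inpp_gadget : aL -> aR -> m <= inpp gadget * 2.
Proof.
move=> aL1 aR1; rewrite /inpp.
have [C [[CA CT] Ctriv] <-] := min_size_attained (path_partition_exists gadget).
have [E EP] := path_cover_ends CA.
have att i c : attach aL aM aR i c = [|| i.+1 == c, aM && (i == c) | i == c.+1].
  by rewrite /attach aL1 aR1.
have lt1 (k : 'I_m) : centre k < m * gap by have := centre_lt k; lia.
have lt0 (k : 'I_m) : (centre k).-1 < m * gap by have := centre_lt k; lia.
have c0 k : 0 < centre k by rewrite /centre; lia.
have cinj (k l : 'I_m) : centre k <= (centre l).+1 -> centre l <= (centre k).+1 -> k = l.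
  by move=> kl lk; apply: val_inj; move: kl lk; rewrite /= /centre /gap; nia.
pose w (k : 'I_m) : gadget := inr k.
pose z (k : 'I_m) : gadget := inl (Ordinal (lt1 k)).
pose l (k : 'I_m) : gadget := inl (Ordinal (lt0 k)).
pose r (k : 'I_m) : gadget := inl (Ordinal (centre_lt k)).
have inlE (i : 'I_(m * gap)) k (lti : k < m * gap) :
    i = k :> nat -> (inl i : gadget) = inl (Ordinal lti).
  by move=> ik; congr inl; apply: val_inj.
have main (k : 'I_m) : exists v, [/\ v = w k \/ v = z k & exists2 S, S \in C & v \in E S].
  have [S1 S1C wS] := cover_mem CT (w k); have [S2 S2C zS] := cover_mem CT (z k).
  have [wE|wE] := boolP (w k \in E S1); first by exists (w k); split; [left|exists S1].
  have [zE|zE] := boolP (z k \in E S2); first by exists (z k); split; [right|exists S2].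
  exfalso.
  (* Among the neighbours of [w k], only [l k] and [r k] are distinct and non-adjacent. *)
  have [lS1 rS1] : l k \in S1 /\ r k \in S1.
    have [_ /(_ _ wS wE)[a [b [aS bS]]]] := EP _ S1C.
    rewrite !gadget_adj; case: a b aS bS => [i|i] [j|j] //= aS bS.
    rewrite !orbF => /attach_near[i1 i2] /attach_near[j1 j2] /andP[ij nij].
    have {}ij : i != j :> nat by apply: contraNneq ij => /val_inj->.
    by have [[Ei Ej]|[Ei Ej]] := near_sides (c0 k) i1 i2 j1 j2 ij nij;
      rewrite /l /r -(inlE _ _ (lt0 k) Ei) -(inlE _ _ (centre_lt k) Ej).
  have [lS2 rS2] : l k \in S2 /\ r k \in S2.
    have [_ /(_ _ zS zE)[a [b [aS bS]]]] := EP _ S2C.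
    have near_in i : (i == (centre k).+1) || (centre k == i.+1) ->
        attach aL aM aR i (centre k).
      by rewrite att => /orP[/eqP->|/eqP->]; rewrite eqxx ?orbT.
    rewrite !gadget_adj; case: a b aS bS => [i|i] [j|j] //= aS bS; rewrite ?orbF.
    + move=> /step_near[i1 i2] /step_near[j1 j2] /andP[ij nij].
      have {}ij : i != j :> nat by apply: contraNneq ij => /val_inj->.
      by have [[Ei Ej]|[Ei Ej]] := near_sides (c0 k) i1 i2 j1 j2 ij nij;
        rewrite /l /r -(inlE _ _ (lt0 k) Ei) -(inlE _ _ (centre_lt k) Ej).
    + move=> zi /attach_near[j1 j2]; have -> : j = k by apply: cinj.
      by rewrite near_in.
    + move=> /attach_near[i1 i2] zj; have -> : i = k by apply: cinj.
      by rewrite near_in.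
    + move=> /attach_near[i1 i2] /attach_near[j1 j2].
      have -> : j = k by apply: cinj.
      have -> : i = k by apply: cinj.
      by rewrite eqxx.
  have SS : S1 = S2.
    apply/eqP/negPn/negP => SN; have /trivIsetP/(_ S1 S2 S1C S2C SN) := Ctriv.
    by rewrite disjoint_subset => /subsetP/(_ _ lS1); rewrite inE lS2.
  have [_ [p _ ->]] := CA _ S1C; rewrite -SS in zS.
  move/path_noC4 => /(_ _ _ _ _ wS zS lS1 rS1); apply=> //.
  - by apply/eqP => -[] E0; have := leq_pred (centre k); rewrite E0 ltnn.
  - by rewrite gadget_adj /= att prednK // eqxx.
  - by rewrite gadget_adj /= att eqxx !orbT.
  - by rewrite gadget_adj /= prednK // eqxx orbT.
  - by rewrite gadget_adj /= eqxx.
have /choice[v vP] := main.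
have vI : injective v.
  move=> i j E0; have [vi _] := vP i; have [vj _] := vP j; rewrite E0 in vi.
  by case: vi vj => -> [] // [] // Ej; apply: cinj; rewrite Ej.
rewrite -{1}[m]card_ord -cardsT -(card_imset _ vI).
apply: (@cover_count _ _ _ E) => [S /EP[]//|_ /imsetP[k _ ->]].
by have [] := vP k.
Qed.

End Gadgets.

(** * The graphs [F1], [F2], [F4], [F5] as local models *)

Section LocalModels.
Variable n : nat.

(** In all three graphs [x_1] is the middle of a path through both legs and [x_2] is the extra
    vertex; they differ in whether [x_2] sees the middle, its two sides, or all three. *)
Definition F145_pos (u : xyz 2 n) : option nat :=
  match u with
  | Xv a => if a == 0 :> nat then Some n else None
  | Yv i => Some (n - i.+1)
  | Zv i => Some (n + i.+1)
  end.

Lemma F145_posN : exists u, F145_pos u = None.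
Proof. by exists (Xv (@Ordinal 2 1 isT)). Qed.

Lemma F145_posS i : 0 < i < 2 * n -> exists u, F145_pos u = Some i.
Proof.
move=> i2n; case: (ltngtP i n) => [lt_in|lt_ni|->]; last by exists (Xv ord0).
  have lti : n - i.+1 < n by lia.
  by exists (Yv (Ordinal lti)) => /=; congr Some; lia.
have lti : i - n.+1 < n by lia.
by exists (Zv (Ordinal lti)) => /=; congr Some; lia.
Qed.

Lemma F1_model u v :
  adj (u : F1 n) v = model_adj false true false n (F145_pos u) (F145_pos v).
Proof.
rewrite edges_adj; last exact: F1_irr.
by case: u v => [[[|[|//]] ?]|[[i ?]|[i ?]]] [[[|[|//]] ?]|[[j ?]|[j ?]]] //=; rewrite /attach; lia.
Qed.

Lemma F4_model u v :
  adj (u : F4 n) v = model_adj true false true n (F145_pos u) (F145_pos v).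
Proof.
rewrite edges_adj; last exact: F4_irr.
by case: u v => [[[|[|//]] ?]|[[i ?]|[i ?]]] [[[|[|//]] ?]|[[j ?]|[j ?]]] //=; rewrite /attach; lia.
Qed.

Lemma F5_model u v :
  adj (u : F5 n) v = model_adj true true true n (F145_pos u) (F145_pos v).
Proof.
rewrite edges_adj; last exact: F5_irr.
by case: u v => [[[|[|//]] ?]|[[i ?]|[i ?]]] [[[|[|//]] ?]|[[j ?]|[j ?]]] //=; rewrite /attach; lia.
Qed.

(** The path runs through the edge [y_1 z_1], at positions [n] and [n.+1], and [x_1] is attached to
    both. *)
Definition F2_pos (u : xyz 1 n) : option nat :=
  match u with
  | Xv _ => None
  | Yv i => Some (n - i)
  | Zv i => Some (n.+1 + i)
  end.

Lemma F2_posN : exists u, F2_pos u = None.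
Proof. by exists (Xv ord0). Qed.

Lemma F2_posS i : 0 < i < 2 * n -> exists u, F2_pos u = Some i.
Proof.
move=> i2n; case: (leqP i n) => [le_in|lt_ni].
  have lti : n - i < n by lia.
  by exists (Yv (Ordinal lti)) => /=; congr Some; lia.
have lti : i - n.+1 < n by lia.
by exists (Zv (Ordinal lti)) => /=; congr Some; lia.
Qed.

Lemma F2_model u v :
  adj (u : F2 n) v = model_adj false true true n (F2_pos u) (F2_pos v).
Proof.
rewrite edges_adj; last exact: F2_irr.
by case: u v => [[[|//] ?]|[[i ?]|[i ?]]] [[[|//] ?]|[[j ?]|[j ?]]] //=; rewrite /attach; lia.
Qed.

End LocalModels.

(** * Unavoidable families *)

(** A threshold is asked for, rather than a single [n], so that several sequences can be served by a
    common [n]. *)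
Definition unavoidable (H : graph_family) (X : nat -> sgraph) : Prop :=
  exists n0, forall n, n0 <= n -> exists2 K, H K & has_induced (X n) K.

Lemma large_not_free (mu : sgraph -> nat) (H : graph_family) c (G : sgraph) :
  (forall G, connected_graph G -> free H G -> mu G <= c) ->
  connected_graph G -> c < mu G -> exists2 K, H K & has_induced G K.
Proof.
move=> Hc cG cmu; apply: contrapT => no.
suff : mu G <= c by rewrite leqNgt cmu.
by apply: Hc => // K HK KG; apply: no; exists K.
Qed.

Lemma large_unavoidable (mu : sgraph -> nat) (H : graph_family) (X : nat -> sgraph) b :
  bounded_on_free mu H -> (forall n, 0 < n -> connected_graph (X n)) ->
  (forall n, n <= mu (X n) * b) -> unavoidable H X.
Proof.
move=> [c Hc] cX muX; exists (c * b).+1 => n nc.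
apply: large_not_free Hc _ _; first by apply: cX; lia.
rewrite ltnNge; apply/negP => le_mu.
by have := leq_trans (muX n) (leq_mul le_mu (leqnn b)); rewrite leqNgt nc.
Qed.

Lemma finite_family_order (H : graph_family) : finite_family H ->
  exists N, forall K, H K -> #|K| <= N.
Proof.
move=> [k [g gP]]; exists (\max_(i < k) #|g i|) => K /gP[i ->].
by apply: (leq_bigmax (F := fun i => #|g i|)).
Qed.

(** A gadget graph with many copies cannot be [H]-free. The member of [H] found in it is connected
    and of order at most [N <= n], so it fits into one copy, that is, into [X n]. *)
Lemma gadget_unavoidable (mu : sgraph -> nat) (H : graph_family) (X : nat -> sgraph)
    (psi : forall n, X n -> option nat) aL aM aR :
  finite_family H -> (forall K, H K -> connected_graph K) ->
  bounded_on_free mu H -> aM || aR ->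
  (forall n m, m <= mu (gadget aL aM aR n m) * 2) ->
  (forall n (u v : X n), adj u v = model_adj aL aM aR n (psi n u) (psi n v)) ->
  (forall n, exists u, psi n u = None) ->
  (forall n i, 0 < i < 2 * n -> exists u, psi n u = Some i) ->
  unavoidable H X.
Proof.
move=> /finite_family_order[N HN] H_conn [c Hc] aMR mu_gad psiA psiN psiS.
(* With [2c + 1] extra vertices the lower bound gives [mu G > c]. *)
exists N => n Nn; pose G := gadget aL aM aR n (c * 2).+1.
have cG : connected_graph G by apply: gadget_connected.
have [|K HK /has_inducedP KG] := large_not_free Hc cG.
  by have := mu_gad n (c * 2).+1; rewrite -/G; lia.
exists K => //; apply/has_inducedP; apply: (model_emb (psiA n)) KG => //.
- exact: psiS.
- exact: H_conn.
- exact: leq_trans (HN K HK) Nn.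
Qed.

Lemma free_noemb (H F : graph_family) (X G : sgraph) :
  family_le H F -> F X -> free H G -> ~ emb X G.
Proof.
move=> HF /HF[K HK /has_inducedP KX] fG XG.
by apply: (fG K HK); apply/has_inducedP; exact: emb_trans KX XG.
Qed.

Lemma bounded_on_free_leq (mu nu : sgraph -> nat) (H : graph_family) :
  (forall G, mu G <= nu G) -> bounded_on_free nu H -> bounded_on_free mu H.
Proof. by move=> le [c Hc]; exists c => G cG fG; apply: leq_trans (le G) (Hc G cG fG). Qed.

Section Unavoidable.
Variable H : graph_family.
Hypotheses (H_fin : finite_family H) (H_conn : forall G, H G -> connected_graph G).

Lemma insc_unavoidable : bounded_on_free insc H ->
  [/\ unavoidable H complete_graph, unavoidable H Sstar & unavoidable H path_graph].
Proof.
move=> bH; split.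
- exact: large_unavoidable bH complete_connected insc_complete.
- apply: (large_unavoidable (b := 1) bH (fun n _ => Sstar_connected n)) => n.
  by rewrite muln1; exact: insc_Sstar.
- exact: large_unavoidable bH path_connected insc_path.
Qed.

Lemma insp_unavoidable : bounded_on_free insp H -> unavoidable H Stilde.
Proof.
move=> bH; apply: (large_unavoidable (b := 1) bH (fun n _ => Stilde_connected n)) => n.
by rewrite muln1; exact: insp_Stilde.
Qed.

Lemma inpc_unavoidable : bounded_on_free inpc H ->
  [/\ unavoidable H complete_graph, unavoidable H star_graph,
      unavoidable H F1 & unavoidable H F2].
Proof.
move=> bH; split.
- exact: large_unavoidable bH complete_connected inpc_complete.
- exact: large_unavoidable bH (fun n _ => star_connected n) inpc_star.
- apply: gadget_unavoidable H_fin H_conn bH _ _ F1_model F145_posN F145_posS => //.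
  by move=> n m; exact: inpc_gadget.
- apply: gadget_unavoidable H_fin H_conn bH _ _ F2_model F2_posN F2_posS => //.
  by move=> n m; exact: inpc_gadget.
Qed.

Lemma inpp_unavoidable : bounded_on_free inpp H ->
  unavoidable H F4 /\ unavoidable H F5.
Proof.
move=> bH; split.
- apply: gadget_unavoidable H_fin H_conn bH _ _ F4_model F145_posN F145_posS => //.
  by move=> n m; exact: inpp_gadget.
- apply: gadget_unavoidable H_fin H_conn bH _ _ F5_model F145_posN F145_posS => //.
  by move=> n m; exact: inpp_gadget.
Qed.

End Unavoidable.

Theorem theorem5p1 (H : graph_family) (H_fin : finite_family H)
    (H_conn : forall G, H G -> connected_graph G) :
  [/\ bounded_on_free insc H <->
      (exists2 n : nat, 4 <= n &
        family_le H [graphs complete_graph n; Sstar n; path_graph n]),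
      bounded_on_free insp H <->
      (exists2 n : nat, 4 <= n &
        family_le H [graphs complete_graph n; Sstar n; Stilde n; path_graph n]),
      bounded_on_free inpc H <->
      (exists2 n : nat, 4 <= n &
        family_le H [graphs complete_graph n; star_graph n; F1 n; F2 n])
    & bounded_on_free inpp H <->
      (exists2 n : nat, 4 <= n &
        family_le H
          [graphs complete_graph n; star_graph n; F1 n; F2 n; F4 n; F5 n])].
Proof.
split; split.
- move=> bH; have [[n1 H1] [n2 H2] [n3 H3]] := insc_unavoidable bH.
  (* The sum is at least 4 and at least each threshold. *)
  exists (4 + n1 + n2 + n3); first lia.
  by move=> K [->|[->|[->|[]]]]; [apply: H1|apply: H2|apply: H3]; lia.
- move=> [n n4 Hle]; have [c Hc] := insc_bounded n; exists c => G cG fG.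
  by apply: Hc => //; apply: free_noemb Hle _ fG; rewrite /add_graph; tauto.
- move=> bH.
  (* A partition is a cover, so boundedness of [insp] yields the conditions for [insc]; only
     [Stilde] has to be added. *)
  have [[n1 H1] [n2 H2] [n3 H3]] := insc_unavoidable (bounded_on_free_leq insc_leq_insp bH).
  have [n4 H4] := insp_unavoidable bH.
  exists (4 + n1 + n2 + n3 + n4); first lia.
  by move=> K [->|[->|[->|[->|[]]]]]; [apply: H1|apply: H2|apply: H4|apply: H3]; lia.
- move=> [n n4 Hle]; have [c Hc] := insp_bounded n; exists c => G cG fG.
  by apply: Hc => //; apply: free_noemb Hle _ fG; rewrite /add_graph; tauto.
- move=> bH; have [[n1 H1] [n2 H2] [n3 H3] [n4 H4]] := inpc_unavoidable H_fin H_conn bH.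
  exists (4 + n1 + n2 + n3 + n4); first lia.
  by move=> K [->|[->|[->|[->|[]]]]]; [apply: H1|apply: H2|apply: H3|apply: H4]; lia.
- move=> [n n4 Hle]; have [|c Hc] := @inpc_bounded n; first lia.
  exists c => G cG fG.
  by apply: Hc => //; apply: free_noemb Hle _ fG; rewrite /add_graph; tauto.
- move=> bH.
  have [[n1 H1] [n2 H2] [n3 H3] [n4 H4]] :=
    inpc_unavoidable H_fin H_conn (bounded_on_free_leq inpc_leq_inpp bH).
  have [[n5 H5] [n6 H6]] := inpp_unavoidable H_fin H_conn bH.
  exists (4 + n1 + n2 + n3 + n4 + n5 + n6); first lia.
  move=> K [->|[->|[->|[->|[->|[->|[]]]]]]];
    by [apply: H1; lia|apply: H2; lia|apply: H3; lia|apply: H4; lia|apply: H5; lia|apply: H6; lia].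
- move=> [n n4 Hle]; have [|c Hc] := @inpp_bounded n; first lia.
  exists c => G cG fG.
  by apply: Hc => //; apply: free_noemb Hle _ fG; rewrite /add_graph; tauto.
Qed.
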